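(* Let $\widehat A,\widehat B,\widehat Q_x,\widehat Q_y\in\mathbb{Q}^{3\times3}$, $\widehat b,\widehat c_1,\widehat c_2\in\mathbb{Q}^3$ be the rational data listed in the context, for which $\widehat A$ and $\widehat B$ are nonsingular. The change of variables $u=\widehat Ax$, $w=\widehat By$ converts the problem $$\min_{x,y,z\in\mathbb{R}^3}\ \tfrac12x^\top\widehat Q_xx+\widehat c_1^\top x+\tfrac12y^\top\widehat Q_yy+\widehat c_2^\top y+\iota_{\mathbb{R}_+^3}(z)\quad\text{s.t.}\quad\widehat Ax+\widehat By+z=\widehat b$$ into the equivalent rational strongly convex $[I_3,I_3,I_3]$ identity-slack quadratic program $$\min_{u,w,z\in\mathbb{R}^3}\ \tfrac12u^\top\widetilde Q_xu+\widetilde c_1^\top u+\tfrac12w^\top\widetilde Q_yw+\widetilde c_2^\top w+\iota_{\mathbb{R}_+^3}(z)\quad\text{s.t.}\quad u+w+z=\widehat b,$$ where $\widetilde Q_x=\widehat A^{-\top}\widehat Q_x\widehat A^{-1}$, $\widetilde Q_y=\widehat B^{-\top}\widehat Q_y\widehat B^{-1}$, $\widetilde c_1=\widehat A^{-\top}\widehat c_1$, $\widetilde c_2=\widehat B^{-\top}\widehat c_2$. The transformed Hessians $\widetilde Q_x,\widetilde Q_y$ remain positive definite, and direct three-block ADMM with $\beta=1$ applied to the transformed problem has a locally attracting non-KKT periodic sequence of minimal period $23$; thus the all-identity model also admits a locally attracting period-$23$ counterexample.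
   Context: Data: $$\widehat A=\begin{bmatrix}5/36&1/60&25/97\\1/60&5/77&5/91\\25/97&5/91&11/12\end{bmatrix},\qquad\widehat B=\begin{bmatrix}4/61&1/54&5/83\\1/54&13/92&23/88\\5/83&23/88&53/58\end{bmatrix},$$ $$\widehat Q_x=\begin{bmatrix}85/93&-1/57&-3/11\\-1/57&99/100&-5/86\\-3/11&-5/86&7/78\end{bmatrix},\qquad\widehat Q_y=\begin{bmatrix}99/100&-1/51&-3/47\\-1/51&72/79&-18/65\\-3/47&-18/65&4/43\end{bmatrix},$$ $$\widehat b=\begin{bmatrix}-2/17\\-1/14\\56/73\end{bmatrix},\qquad\widehat c_1=\begin{bmatrix}33/98\\-33/25\\-24/55\end{bmatrix},\qquad\widehat c_2=\begin{bmatrix}-31/99\\19/36\\-11/20\end{bmatrix}.$$ $\iota_C$ is the indicator function of $C$; $[a]_+$, $[a]_-$ are the componentwise $\max\{a_i,0\}$, $\min\{a_i,0\}$. Direct ADMM with $\beta=1$ for the transformed problem (order $u\to w\to z\to\lambda$): with augmented Lagrangian $\mathcal L(u,w,z,\lambda)=\tfrac12u^\top\widetilde Q_xu+\widetilde c_1^\top u+\tfrac12w^\top\widetilde Q_yw+\widetilde c_2^\top w+\iota_{\mathbb{R}_+^3}(z)-\lambda^\top r+\tfrac12\|r\|^2$, $r=u+w+z-\widehat b$, $$u^{k+1}=\operatorname{argmin}_u\mathcal L(u,w^k,z^k,\lambda^k),\quad w^{k+1}=\operatorname{argmin}_w\mathcal L(u^{k+1},w,z^k,\lambda^k),\quad z^{k+1}=\operatorname{argmin}_z\mathcal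 L(u^{k+1},w^{k+1},z,\lambda^k),$$ $$\lambda^{k+1}=\lambda^k-(u^{k+1}+w^{k+1}+z^{k+1}-\widehat b).$$ Reduced state: $(w,t)\in\mathbb{R}^6$ with $t=z+\lambda$, from which $z=[t]_+$ and $\lambda=[t]_-$; it determines the next reduced state. ''Locally attracting'' means that there is an open set of reduced initial states containing the phase-zero state of the periodic sequence such that, from every initial state in it, the reduced ADMM sequence $(w^k,t^k)$ converges phasewise to the periodic sequence $(\bar w^j,\bar t^j)_{0\le j<23}$, i.e. $(w^{23\ell+j},t^{23\ell+j})\to(\bar w^j,\bar t^j)$ as $\ell\to\infty$ for each $j$. A KKT point is $(u,w,z,\lambda)$ with $\lambda=\widetilde Q_xu+\widetilde c_1=\widetilde Q_yw+\widetilde c_2$, $u+w+z=\widehat b$, $z\in\mathbb{R}_+^3$, $\lambda\in N_{\mathbb{R}_+^3}(z)$ (normal cone); a sequence is non-KKT if none of its elements is a KKT point. *)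

(* Defs.v *)
From HB Require Import structures.
From mathcomp Require Import all_boot all_order all_algebra.
From mathcomp Require Import all_classical all_reals all_analysis.

Set Implicit Arguments.
Unset Strict Implicit.
Unset Printing Implicit Defensive.

Import Order.TTheory GRing.Theory Num.Theory numFieldNormedType.Exports.

Local Open Scope classical_set_scope.
Local Open Scope ring_scope.

(* The Euclidean inner product; the library norm on 'cV[R]_n is the sup norm. *)
Definition dotv (R : pzRingType) (n : nat) (x y : 'cV[R]_n) : R :=
  (x^T *m y) 0 0.

Definition quad (R : fieldType) (n : nat) (Q : 'M[R]_n) (c x : 'cV[R]_n) : R :=
  2^-1 * dotv x (Q *m x) + dotv c x.

Definition posdef (R : realType) (n : nat) (Q : 'M[R]_n) : Prop :=
  Q^T = Q /\ forall x : 'cV[R]_n, x != 0 -> 0 < dotv x (Q *m x).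

Definition strongly_convex (R : realType) (n : nat) (f : 'cV[R]_n -> R) : Prop :=
  exists2 mu : R, 0 < mu &
    forall (x y : 'cV[R]_n) (a : R), 0 <= a <= 1 ->
      f (a *: x + (1 - a) *: y) <=
        a * f x + (1 - a) * f y - mu / 2 * a * (1 - a) * dotv (x - y) (x - y).

Definition argmin (R : realType) (X : Type) (f : X -> \bar R) : set X :=
  [set x | forall y, (f x <= f y)%E].

Definition indicator (R : realType) (X : Type) (C : set X) (x : X) : \bar R :=
  if x \in C then 0%E else +oo%E.

Definition orthant (R : realType) (n : nat) : set 'cV[R]_n :=
  [set z | forall i, 0 <= z i 0].

Definition normal_cone (R : realType) (n : nat) (C : set 'cV[R]_n)
    (z : 'cV[R]_n) : set 'cV[R]_n :=
  [set v | C z /\ forall y, C y -> dotv v (y - z) <= 0].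

Definition pos_part (R : realType) (n : nat) (t : 'cV[R]_n) : 'cV[R]_n :=
  \col_i Num.max (t i 0) 0.

Definition neg_part (R : realType) (n : nat) (t : 'cV[R]_n) : 'cV[R]_n :=
  \col_i Num.min (t i 0) 0.

(* Data of the problem
     min 1/2 x^T Qx x + c1^T x + 1/2 y^T Qy y + c2^T y + iota(z)
     s.t. A x + B y + z = b,
   iota being the indicator of the nonnegative orthant. *)
Record slack_qp (F : Type) (n : nat) := SlackQP {
  mxA : 'M[F]_n;
  mxB : 'M[F]_n;
  hessx : 'M[F]_n;
  hessy : 'M[F]_n;
  rhs : 'cV[F]_n;
  linx : 'cV[F]_n;
  liny : 'cV[F]_n
}.

Definition map_qp (F G : Type) (f : F -> G) (n : nat) (p : slack_qp F n) :
    slack_qp G n :=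
  SlackQP (map_mx f (mxA p)) (map_mx f (mxB p))
    (map_mx f (hessx p)) (map_mx f (hessy p))
    (map_mx f (rhs p)) (map_mx f (linx p)) (map_mx f (liny p)).

(* The problem in the variables u = A x, w = B y. *)
Definition transformed (F : fieldType) (n : nat) (p : slack_qp F n) :
    slack_qp F n :=
  SlackQP 1%:M 1%:M
    ((invmx (mxA p))^T *m hessx p *m invmx (mxA p))
    ((invmx (mxB p))^T *m hessy p *m invmx (mxB p))
    (rhs p)
    ((invmx (mxA p))^T *m linx p)
    ((invmx (mxB p))^T *m liny p).

Definition residual (R : realType) (n : nat) (p : slack_qp R n)
    (x y z : 'cV[R]_n) : 'cV[R]_n :=
  mxA p *m x + mxB p *m y + z - rhs p.

Record program (R : realType) (X : Type) := Program {
  objective : X -> \bar R;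
  feasible : set X
}.

Definition program_of (R : realType) (n : nat) (p : slack_qp R n) :
    program R ('cV[R]_n * 'cV[R]_n * 'cV[R]_n) :=
  Program
    (fun v => let: (x, y, z) := v in
       ((quad (hessx p) (linx p) x + quad (hessy p) (liny p) y)%:E
        + indicator R (@orthant R n) z)%E)
    [set v | let: (x, y, z) := v in residual p x y z = 0].

Definition equivalent_via (R : realType) (X Y : Type) (phi : X -> Y)
    (P : program R X) (Q : program R Y) : Prop :=
  [/\ bijective phi,
      forall v, feasible Q (phi v) <-> feasible P v &
      forall v, objective Q (phi v) = objective P v].

(* Penalty parameter beta = 1. *)
Definition aug_lagrangian (R : realType) (n : nat) (p : slack_qp R n)
    (u w z l : 'cV[R]_n) : \bar R :=
  let r := residual p u w z in
  ((quad (hessx p) (linx p) u + quad (hessy p) (liny p) w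
    - dotv l r + 2^-1 * dotv r r)%:E + indicator R (@orthant R n) z)%E.

Record iterate (R : Type) (n : nat) := Iterate {
  itu : 'cV[R]_n;
  itw : 'cV[R]_n;
  itz : 'cV[R]_n;
  itl : 'cV[R]_n
}.

Definition admm_step (R : realType) (n : nat) (p : slack_qp R n)
    (s s' : iterate R n) : Prop :=
  [/\ argmin (fun u => aug_lagrangian p u (itw s) (itz s) (itl s))
        = [set itu s'],
      argmin (fun w => aug_lagrangian p (itu s') w (itz s) (itl s))
        = [set itw s'],
      argmin (fun z => aug_lagrangian p (itu s') (itw s') z (itl s))
        = [set itz s'] &
      itl s' = itl s - residual p (itu s') (itw s') (itz s')].

Definition admm_sequence (R : realType) (n : nat) (p : slack_qp R n)
    (s : nat -> iterate R n) : Prop :=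
  forall k, admm_step p (s k) (s k.+1).

Definition reduced (R : realType) (n : nat) (s : iterate R n) :
    'cV[R]_n * 'cV[R]_n :=
  (itw s, itz s + itl s).

(* The u-component of the initial iterate is irrelevant: the step
   recomputes it from the other components. *)
Definition starts_at (R : realType) (n : nat) (x : 'cV[R]_n * 'cV[R]_n)
    (s : nat -> iterate R n) : Prop :=
  [/\ itw (s 0) = x.1, itz (s 0) = pos_part x.2 & itl (s 0) = neg_part x.2].

Definition kkt_point (R : realType) (n : nat) (p : slack_qp R n)
    (s : iterate R n) : Prop :=
  [/\ (mxA p)^T *m itl s = hessx p *m itu s + linx p,
      (mxB p)^T *m itl s = hessy p *m itw s + liny p,
      residual p (itu s) (itw s) (itz s) = 0,
      orthant (itz s) &
      normal_cone (@orthant R n) (itz s) (itl s)].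

Definition minimal_period (X : Type) (N : nat) (s : nat -> X) : Prop :=
  [/\ (0 < N)%N,
      forall k, s (k + N)%N = s k &
      forall m, (0 < m < N)%N -> ~ (forall k, s (k + m)%N = s k)].

Definition locally_attracting (R : realType) (n : nat) (p : slack_qp R n)
    (N : nat) (s : nat -> iterate R n) : Prop :=
  exists U : set ('cV[R]_n * 'cV[R]_n),
    [/\ open U,
        U (reduced (s 0)) &
        forall x, U x ->
          (exists v, admm_sequence p v /\ starts_at x v) /\
          (forall v, admm_sequence p v -> starts_at x v ->
             forall j, (j < N)%N ->
               reduced (v (N * k + j)%N) @[k --> \oo] --> reduced (s j))].

Definition attracting_nonKKT_cycle (R : realType) (n : nat)
    (p : slack_qp R n) (N : nat) (s : nat -> iterate R n) : Prop :=
  [/\ admm_sequence p s,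
      minimal_period N s,
      minimal_period N (fun k => reduced (s k)),
      locally_attracting p N s &
      forall k, ~ kkt_point p (s k)].

Definition mx_of_rows (F : nmodType) (m n : nat) (rows : seq (seq F)) :
    'M[F]_(m, n) :=
  \matrix_(i, j) (nth [::] rows i)`_j.

Definition hatA : 'M[rat]_3 := mx_of_rows 3 3
  [:: [:: 5 / 36;  1 / 60;  25 / 97];
      [:: 1 / 60;  5 / 77;  5 / 91];
      [:: 25 / 97; 5 / 91;  11 / 12]].

Definition hatB : 'M[rat]_3 := mx_of_rows 3 3
  [:: [:: 4 / 61;  1 / 54;  5 / 83];
      [:: 1 / 54;  13 / 92; 23 / 88];
      [:: 5 / 83;  23 / 88; 53 / 58]].

Definition hatQx : 'M[rat]_3 := mx_of_rows 3 3
  [:: [:: 85 / 93;   - (1 / 57); - (3 / 11)];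
      [:: - (1 / 57); 99 / 100;  - (5 / 86)];
      [:: - (3 / 11); - (5 / 86); 7 / 78]].

Definition hatQy : 'M[rat]_3 := mx_of_rows 3 3
  [:: [:: 99 / 100;  - (1 / 51);  - (3 / 47)];
      [:: - (1 / 51); 72 / 79;    - (18 / 65)];
      [:: - (3 / 47); - (18 / 65); 4 / 43]].

Definition hatb : 'cV[rat]_3 := mx_of_rows 3 1
  [:: [:: - (2 / 17)]; [:: - (1 / 14)]; [:: 56 / 73]].

Definition hatc1 : 'cV[rat]_3 := mx_of_rows 3 1
  [:: [:: 33 / 98]; [:: - (33 / 25)]; [:: - (24 / 55)]].

Definition hatc2 : 'cV[rat]_3 := mx_of_rows 3 1
  [:: [:: - (31 / 99)]; [:: 19 / 36]; [:: - (11 / 20)]].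

Definition hat_qp : slack_qp rat 3 :=
  SlackQP hatA hatB hatQx hatQy hatb hatc1 hatc2.

(* Main.v *)
Require Import Defs.
From HB Require Import structures.
From mathcomp Require Import all_boot all_order all_algebra.
From mathcomp Require Import all_classical all_reals all_analysis.
From mathcomp Require Import ring lra ssrZ zify.
From Stdlib Require BinInt.
Import Order.TTheory GRing.Theory Num.Theory numFieldNormedType.Exports.
Local Open Scope classical_set_scope.
Local Open Scope ring_scope.
Set Implicit Arguments.
Unset Strict Implicit.
Unset Printing Implicit Defensive.

(** In the reduced state (w, t) with t = z + lambda, one has z = [t]_+ and
    lambda = [t]_-, hence z - lambda = |t|.  Since both Hessians are positive
    definite, every block subproblem has exactly one minimizer, and the
    optimality conditions show that an ADMM step is the map
    [reduced_map] ([admm_step_reduced]).  This map is continuous and affine on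
    each orthant of the t-coordinates: it agrees with an affine [branch] as
    soon as the signs of t are prescribed.

    The periodic sequence is the orbit that follows a fixed list of 23 sign
    vectors, [itinerary].  Let T be the composition of the 23 corresponding
    branches and L its linear part.  Enclosures by integer balls prove three
    numerical facts ([cycle_certificateP], [hat_certificate]).
    - The columns of L^6 have norms whose sum is at most 3/4.  Hence L^6
      contracts the sup norm by 3/4 and L fixes no nonzero vector, so the affine
      map T has a fixed point x0 ([affine_fixpoint]).
    - For an explicit decimal point c, the residual T c - c is tiny.  Hence x0
      lies in a tiny box around c ([near_fixpoint_le]).
    - Starting from that box, every t-coordinate keeps its prescribed sign along
      the 23 branches, with margin 1/1000.  Hence the branches followed by x0
      are those that [reduced_map] itself selects.

    So x0 is a periodic point of [reduced_map].  States near x0 select the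
    same branches, after 23 steps their distance vector to x0 has been
    multiplied by L, and since the powers of L are bounded and tend to 0 they
    stay near the cycle for ever and converge to it phasewise
    ([cycle_attracting]).  The period is minimal because 23 is prime and
    the sign vectors are not all equal ([minimal_period_prime]).  A KKT point
    would be a fixed point of [reduced_map] ([kkt_point_fixed]), which a
    nonconstant cycle does not contain.

    The remaining claims are linear algebra: congruence by A^-1 preserves
    positive definiteness, and a positive definite form dominates a positive
    multiple of the Euclidean one ([posdef_lower]), which is strong
    convexity.  The transformed rational data witness the final existential. *)

(** * Inner product and positive definite forms *)

Section InnerProduct.
Context {R : comPzRingType} {n : nat}.
Implicit Types x y z : 'cV[R]_n.

Lemma dotvE x y : dotv x y = \sum_i x i 0 * y i 0.
Proof. by rewrite /dotv mxE; apply: eq_bigr => i _; rewrite mxE. Qed.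

Lemma dotvC x y : dotv x y = dotv y x.
Proof. by rewrite !dotvE; apply: eq_bigr => i _; rewrite mulrC. Qed.

Lemma dotvDr x y z : dotv x (y + z) = dotv x y + dotv x z.
Proof. by rewrite /dotv mulmxDr mxE. Qed.

Lemma dotvDl x y z : dotv (x + y) z = dotv x z + dotv y z.
Proof. by rewrite dotvC dotvDr !(dotvC z). Qed.

Lemma dotvNr x y : dotv x (- y) = - dotv x y.
Proof. by rewrite /dotv mulmxN mxE. Qed.

Lemma dotvNl x y : dotv (- x) y = - dotv x y.
Proof. by rewrite dotvC dotvNr dotvC. Qed.

Lemma dotvZr a x y : dotv x (a *: y) = a * dotv x y.
Proof. by rewrite /dotv -scalemxAr mxE. Qed.

Lemma dotvZl a x y : dotv (a *: x) y = a * dotv x y.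
Proof. by rewrite dotvC dotvZr dotvC. Qed.

Lemma dotv0r x : dotv x 0 = 0.
Proof. by rewrite /dotv mulmx0 mxE. Qed.

Lemma dotv0l x : dotv 0 x = 0.
Proof. by rewrite dotvC dotv0r. Qed.

Lemma dotv_mulmxl m (A : 'M[R]_(n, m)) (u : 'cV[R]_m) x :
  dotv (A *m u) x = dotv u (A^T *m x).
Proof. by rewrite /dotv trmx_mul mulmxA. Qed.

Lemma dotv_sym (Q : 'M[R]_n) x y : Q^T = Q -> dotv x (Q *m y) = dotv y (Q *m x).
Proof. by move=> sQ; rewrite dotvC dotv_mulmxl sQ. Qed.

End InnerProduct.

Lemma dotv_ge0 (R : realDomainType) n (x : 'cV[R]_n) : 0 <= dotv x x.
Proof. by rewrite dotvE sumr_ge0 // => i _; rewrite -expr2 sqr_ge0. Qed.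

Lemma dotv_eq0 (R : realDomainType) n (x : 'cV[R]_n) : (dotv x x == 0) = (x == 0).
Proof.
apply/eqP/eqP => [|->]; last exact: dotv0l.
rewrite dotvE => /psumr_eq0P h; apply/colP => i; rewrite mxE; apply/eqP.
suff : x i 0 * x i 0 = 0 by move/eqP; rewrite mulf_eq0 orbb.
by apply: h => // j _; rewrite -expr2 sqr_ge0.
Qed.

Lemma dotv_gt0 (R : realDomainType) n (x : 'cV[R]_n) : x != 0 -> 0 < dotv x x.
Proof. by move=> x0; rewrite lt_def dotv_eq0 x0 dotv_ge0. Qed.

Lemma unitmx_inj (F : fieldType) n (M : 'M[F]_n) :
  (forall x : 'cV_n, M *m x = 0 -> x = 0) -> M \in unitmx.
Proof.
move=> h; rewrite -unitmx_tr -row_free_unit -kermx_eq0; apply/rowV0P => v.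
move=> /sub_kermxP vM; apply: trmx_inj; rewrite trmx0; apply: h.
by rewrite -[M]trmxK -trmx_mul vM trmx0.
Qed.

Section PositiveDefinite.
Context {R : realType} {n : nat}.
Implicit Types (Q : 'M[R]_n) (x y c : 'cV[R]_n).

Lemma posdef_ge0 Q x : posdef Q -> 0 <= dotv x (Q *m x).
Proof.
move=> [_ h]; have [->|/h/ltW//] := eqVneq x 0; by rewrite dotv0l.
Qed.

Lemma posdef_unit Q : posdef Q -> Q \in unitmx.
Proof.
move=> [_ h]; apply: unitmx_inj => x Qx; apply/eqP; apply: contraT => /h.
by rewrite Qx dotv0r ltxx.
Qed.

Lemma posdef_add1 Q : posdef Q -> posdef (Q + 1%:M).
Proof.
move=> pQ; split=> [|x x0]; first by rewrite linearD /= trmx1 pQ.1.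
by rewrite mulmxDl mul1mx dotvDr ltr_wpDl ?posdef_ge0 ?dotv_gt0.
Qed.

Lemma posdef_congr Q (A : 'M[R]_n) :
  posdef Q -> A \in unitmx -> posdef (A^T *m Q *m A).
Proof.
move=> [sQ pQ] uA; split; first by rewrite !trmx_mul trmxK sQ !mulmxA.
move=> x x0; rewrite -!mulmxA -dotv_mulmxl; apply: pQ.
by apply: contraNneq x0 => Ax; rewrite -(mulKmx uA x) Ax mulmx0.
Qed.

(** Each product |x_i x_j| is at most the squared Euclidean norm of x, so the
    sum of the absolute values of the entries bounds the form. *)
Lemma dotv_mul_le Q :
  exists2 C : R, 0 < C & forall x, dotv x (Q *m x) <= C * dotv x x.
Proof.
pose C := 1 + \sum_i \sum_j `|Q i j|; exists C.
  by rewrite ltr_pwDl // sumr_ge0 // => i _; rewrite sumr_ge0.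
move=> x; have xi i : x i 0 ^+ 2 <= dotv x x.
  rewrite dotvE (bigD1 i) //= expr2 lerDl sumr_ge0 // => j _.
  by rewrite -expr2 sqr_ge0.
rewrite mulrDl mul1r ler_wpDl ?dotv_ge0 // dotvE mulr_suml ler_sum // => i _.
rewrite mxE mulr_sumr mulr_suml ler_sum // => j _.
have := xi i; have := xi j; move: (x i 0) (x j 0) (Q i j) (dotv x x) => a b c d h1 h2.
have ab : `|a * b| <= d.
  by rewrite ler_norml; apply/andP; split; nra.
rewrite mulrCA; apply: le_trans (ler_norm _) _; rewrite normrM.
by apply: ler_wpM2l.
Qed.

(** The form is nonnegative at c x - a y with a = <x, y>_Q and c = <y, y>_Q. *)
Lemma posdef_CauchySchwarz Q x y : posdef Q ->
  dotv x (Q *m y) ^+ 2 <= dotv x (Q *m x) * dotv y (Q *m y).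
Proof.
move=> pQ; have [->|y0] := eqVneq y 0; first by rewrite mulmx0 !dotv0r mulr0 expr0n.
have yy := pQ.2 _ y0.
set a := dotv x (Q *m y); set c := dotv y (Q *m y) in yy *.
have := posdef_ge0 (c *: x - a *: y) pQ.
rewrite mulmxBr -!scalemxAr !dotvDl !dotvDr !dotvNl !dotvNr !dotvZl !dotvZr.
rewrite (dotv_sym y x pQ.1) -/a -/c; set b := dotv x (Q *m x) => H.
by nra.
Qed.

(** Cauchy-Schwarz for Q between x and Q^-1 x gives
    (x.x)^2 <= (x.Qx) (x.Q^-1 x), and x.Q^-1 x is at most a constant
    times x.x. *)
Lemma posdef_lower Q : posdef Q ->
  exists2 mu : R, 0 < mu & forall x, mu * dotv x x <= dotv x (Q *m x).
Proof.
move=> pQ; have uQ := posdef_unit pQ.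
have [C C0 hC] := dotv_mul_le (invmx Q).
exists C^-1; rewrite ?invr_gt0 // => x.
have := posdef_CauchySchwarz x (invmx Q *m x) pQ.
rewrite mulKVmx // (dotvC (invmx Q *m x)).
have := hC x; have := posdef_ge0 x pQ; have := dotv_ge0 x.
move: (dotv x x) (dotv x (Q *m x)) (dotv x (invmx Q *m x)) => s a b s0 a0 hb h.
rewrite ler_pdivrMl //; have [->|sn0] := eqVneq s 0; first by rewrite mulr_ge0 // ltW.
have sp : 0 < s by rewrite lt_def sn0.
rewrite -(ler_pM2r sp) -expr2; apply: le_trans h _.
by rewrite (mulrC C) -mulrA; apply: ler_wpM2l.
Qed.

Lemma quadD Q c x y : Q^T = Q ->
  quad Q c (x + y) = quad Q c x + dotv y (Q *m x + c) + 2^-1 * dotv y (Q *m y).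
Proof.
move=> sQ; rewrite /quad mulmxDr !dotvDl !dotvDr (dotv_sym x y sQ) (dotvC c y).
by field.
Qed.

(** The defect of convexity of a quadratic function is exactly its form at
    x - y, so that strong convexity reduces to a lower bound on the form. *)
Lemma quad_convexity Q c x y (a : R) : Q^T = Q ->
  quad Q c (a *: x + (1 - a) *: y) = a * quad Q c x + (1 - a) * quad Q c y
    - 2^-1 * a * (1 - a) * dotv (x - y) (Q *m (x - y)).
Proof.
move=> sQ; rewrite /quad !mulmxDr mulmxN -!scalemxAr !dotvDl !dotvDr !dotvNl !dotvNr.
rewrite !dotvZl !dotvZr (dotv_sym y x sQ).
by field.
Qed.

Lemma posdef_strongly_convex Q c : posdef Q -> strongly_convex (quad Q c).
Proof.
move=> pQ; have [mu mu0 h] := posdef_lower pQ; exists mu => // x y a /andP[a0 a1].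
rewrite quad_convexity ?pQ.1 // lerD2l lerN2.
have := h (x - y); set s := dotv (x - y) (x - y); set d := dotv (x - y) _ => hd.
have -> : mu / 2 * a * (1 - a) * s = 2^-1 * a * (1 - a) * (mu * s) by field.
by apply: ler_wpM2l => //; rewrite !mulr_ge0 // ?invr_ge0 // subr_ge0.
Qed.

End PositiveDefinite.

(** * One ADMM step on reduced states *)

Section Branches.
Context {R : comPzRingType} {n : nat}.
Implicit Types (K : 'M[R]_n) (b g : 'cV[R]_n) (s : 'I_n -> bool).

(** For t in the closed orthant with sign vector s ([true] meaning nonnegative),
    [signed_abs s t] is |t| = z - lambda and [signed_neg s t] is
    [t]_- = lambda.  Both are linear in t, whatever the signs of t are. *)
Definition signed_abs s (t : 'cV[R]_n) : 'cV[R]_n :=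
  \col_i (if s i then t i 0 else - t i 0).

Definition signed_neg s (t : 'cV[R]_n) : 'cV[R]_n :=
  \col_i (if s i then 0 else t i 0).

(** With K1 = (Q + 1)^-1 and g1 = K1 c, this is the solution u of
    (Q + 1) u = lambda - z - w + b - c, the stationarity condition of the
    first block; [branch] appends the second block, then
    t = lambda - (u + w - b). *)
Definition branch_u K1 b g1 s (x : 'cV[R]_n * 'cV[R]_n) : 'cV[R]_n :=
  K1 *m (b - signed_abs s x.2 - x.1) - g1.

Definition branch K1 K2 b g1 g2 s (x : 'cV[R]_n * 'cV[R]_n) :=
  let u := branch_u K1 b g1 s x in
  let w := K2 *m (b - signed_abs s x.2 - u) - g2 in
  (w, signed_neg s x.2 + b - (u + w)).

End Branches.

Section ArgMin.
Context {R : realType}.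

Lemma argmin_eq_set1 (X : Type) (f : X -> \bar R) (x : X) :
  (forall y, y <> x -> (f x < f y)%E) -> argmin f = [set x].
Proof.
move=> h; apply/seteqP; split => [y /= hy|_ /= ->].
  by apply: contrapT => /h; rewrite ltNge hy.
by move=> y; have [->//|/h/ltW] := pselect (y = x).
Qed.

Lemma set1_inj (X : Type) : injective (@set1 X).
Proof. by move=> x y exy; have : [set y] x by rewrite -exy. Qed.

Lemma indicator_in (X : Type) (C : set X) (x : X) : C x -> indicator R C x = 0%E.
Proof. by move=> Cx; rewrite /indicator mem_set. Qed.

Lemma indicator_notin (X : Type) (C : set X) (x : X) :
  ~ C x -> indicator R C x = +oo%E.
Proof. by move=> nCx; rewrite /indicator memNset. Qed.

Lemma pos_part_orthant n (t : 'cV[R]_n) : orthant (pos_part t).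
Proof. by move=> i; rewrite mxE le_max lexx orbT. Qed.

Lemma pos_neg_partK n (t : 'cV[R]_n) : pos_part t + neg_part t = t.
Proof. by apply/colP => i; rewrite !mxE addr_max_min addr0. Qed.

End ArgMin.

Section Admm.
Context {R : realType} {n : nat} (p : slack_qp R n).
Hypotheses (A1 : mxA p = 1%:M) (B1 : mxB p = 1%:M).
Hypotheses (pdx : posdef (hessx p)) (pdy : posdef (hessy p)).
Local Notation V := ('cV[R]_n * 'cV[R]_n)%type.

Definition resx := invmx (hessx p + 1%:M).
Definition resy := invmx (hessy p + 1%:M).

Definition reduced_branch : ('I_n -> bool) -> V -> V :=
  branch resx resy (rhs p) (resx *m linx p) (resy *m liny p).

Definition state_signs (x : V) : 'I_n -> bool := fun i => 0 <= x.2 i 0.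

Definition reduced_u (x : V) : 'cV[R]_n :=
  branch_u resx (rhs p) (resx *m linx p) (state_signs x) x.

Definition reduced_map (x : V) : V := reduced_branch (state_signs x) x.

Definition state_iterate (u : 'cV[R]_n) (x : V) : iterate R n :=
  Iterate u x.1 (pos_part x.2) (neg_part x.2).

Lemma residualE u w z : residual p u w z = u + w + z - rhs p.
Proof. by rewrite /residual A1 B1 !mul1mx. Qed.

(** The first-order term of the expansion at u0 vanishes, and the second-order
    term is half the form of Q + 1. *)
Lemma quad_aug_min (Q : 'M[R]_n) (c l d u0 u : 'cV[R]_n) : posdef Q ->
  (Q + 1%:M) *m u0 = l - c - d -> u <> u0 ->
  quad Q c u0 - dotv l (u0 + d) + 2^-1 * dotv (u0 + d) (u0 + d) <
  quad Q c u - dotv l (u + d) + 2^-1 * dotv (u + d) (u + d).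
Proof.
move=> pQ e u_u0.
have [h -> h0] : exists2 h, u = u0 + h & h != 0.
  by exists (u - u0); rewrite ?subr_eq0 1?addrC ?subrK //; apply/eqP.
rewrite quadD ?pQ.1 //.
have : dotv h (Q *m u0 + c - l + (u0 + d)) = 0.
  suff -> : Q *m u0 + c - l + (u0 + d) = 0 by rewrite dotv0r.
  move: e; rewrite mulmxDl mul1mx => /eqP; rewrite -subr_eq0 => /eqP <-.
  by apply/colP => i; rewrite !mxE; ring.
have := (posdef_add1 pQ).2 h h0.
rewrite mulmxDl mul1mx !(dotvDl, dotvDr, dotvNr) (dotvC l h) (dotvC u0 h)
   (dotvC d h) (dotvC d u0).
by lra.
Qed.

(** The projection onto a half-line sees its points under an obtuse angle; this
    makes the projection the unique nearest point coordinatewise. *)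
Lemma sqr_dist_pos_part (a b : R) : 0 <= b ->
  (Num.max a 0 - a) ^+ 2 + (b - Num.max a 0) ^+ 2 <= (b - a) ^+ 2.
Proof. by move=> b0; case: (leP a 0) => h; nra. Qed.

Lemma pos_part_min (t y : 'cV[R]_n) : orthant y -> y <> pos_part t ->
  dotv (pos_part t - t) (pos_part t - t) < dotv (y - t) (y - t).
Proof.
move=> oy yt; have h0 : y - pos_part t != 0 by rewrite subr_eq0; apply/eqP.
apply: lt_le_trans (_ : dotv (pos_part t - t) (pos_part t - t)
  + dotv (y - pos_part t) (y - pos_part t) <= _); first by rewrite ltrDl dotv_gt0.
rewrite !dotvE -big_split /=; apply: ler_sum => i _.
by rewrite !mxE -!expr2 sqr_dist_pos_part.
Qed.

Section OneStep.
Context (x : V).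
Let u := reduced_u x.
Let w := (reduced_map x).1.
Let t := (reduced_map x).2.

Lemma signed_abs_state : signed_abs (state_signs x) x.2 = pos_part x.2 - neg_part x.2.
Proof.
apply/colP => i; rewrite !mxE /state_signs.
by case: (leP 0 (x.2 i 0)) => h; rewrite ?subr0 ?sub0r.
Qed.

Lemma signed_neg_state : signed_neg (state_signs x) x.2 = neg_part x.2.
Proof.
by apply/colP => i; rewrite !mxE /state_signs; case: (leP 0 (x.2 i 0)).
Qed.

Lemma reduced_uE : (hessx p + 1%:M) *m u =
  neg_part x.2 - linx p - (x.1 + pos_part x.2 - rhs p).
Proof.
rewrite /u /reduced_u /branch_u -mulmxBr /resx mulKVmx ?posdef_unit //; last first.
  exact: posdef_add1.
by rewrite signed_abs_state; apply/colP => i; rewrite !mxE; ring.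
Qed.

Lemma reduced_wE : (hessy p + 1%:M) *m w =
  neg_part x.2 - liny p - (u + pos_part x.2 - rhs p).
Proof.
rewrite /w /= -mulmxBr /resy mulKVmx ?posdef_unit //; last first.
  exact: posdef_add1.
by rewrite signed_abs_state -/(reduced_u x) -/u; apply/colP => i; rewrite !mxE; ring.
Qed.

Lemma reduced_tE : t = neg_part x.2 - (u + w - rhs p).
Proof.
rewrite /t /= signed_neg_state -/(reduced_u x) -/u -/w.
by apply/colP => i; rewrite !mxE; ring.
Qed.

Lemma argmin_u :
  argmin (fun u => aug_lagrangian p u x.1 (pos_part x.2) (neg_part x.2)) = [set u].
Proof.
apply: argmin_eq_set1 => y yu; rewrite /aug_lagrangian !residualE.
rewrite indicator_in ?adde0 ?lte_fin; last exact: pos_part_orthant.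
have := quad_aug_min pdx reduced_uE yu.
by rewrite !addrA; lra.
Qed.

Lemma argmin_w :
  argmin (fun w => aug_lagrangian p u w (pos_part x.2) (neg_part x.2)) = [set w].
Proof.
apply: argmin_eq_set1 => y yw; rewrite /aug_lagrangian !residualE.
rewrite indicator_in ?adde0 ?lte_fin; last exact: pos_part_orthant.
have E v : u + v + pos_part x.2 - rhs p = v + (u + pos_part x.2 - rhs p).
  by rewrite [in LHS](addrC u) !addrA.
by have := quad_aug_min pdy reduced_wE yw; rewrite !E; lra.
Qed.

(** Completing the square turns the objective into half the squared distance
    from z to t, up to a constant. *)
Lemma argmin_z :
  argmin (fun z => aug_lagrangian p u w z (neg_part x.2)) = [set pos_part t].
Proof.
apply: argmin_eq_set1 => y yt; rewrite /aug_lagrangian !residualE.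
rewrite [X in (_ + X < _)%E]indicator_in; last exact: pos_part_orthant.
have [oy|noy] := pselect (orthant y); last first.
  by rewrite [X in (_ < _ + X)%E]indicator_notin // addeC /= ltry.
rewrite indicator_in // !adde0 lte_fin.
have E z : u + w + z - rhs p = (z - t) + neg_part x.2.
  by rewrite reduced_tE; apply/colP => i; rewrite !mxE; ring.
have := pos_part_min oy yt.
rewrite !E !(dotvDl, dotvDr) !(dotvNl, dotvNr) !(dotvC (neg_part x.2)).
by lra.
Qed.

Lemma multiplierE : neg_part x.2 - residual p u w (pos_part t) = neg_part t.
Proof.
have -> : neg_part t = t - pos_part t by rewrite -[t in t - _]pos_neg_partK addrC addKr.
rewrite residualE [X in _ = X - _]reduced_tE.
move: (pos_part t) (neg_part x.2) (u + w) => a c e.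
by apply/colP => i; rewrite !mxE; ring.
Qed.

(** The block minimizers being unique, the relation [admm_step] is the graph of
    a function of the reduced state. *)
Lemma admm_step_reduced (s s' : iterate R n) :
  itw s = x.1 -> itz s = pos_part x.2 -> itl s = neg_part x.2 ->
  admm_step p s s' <-> s' = state_iterate u (reduced_map x).
Proof.
move=> sw sz sl; rewrite /admm_step sw sz sl argmin_u; split.
- case: s' => u' w' z' l' /= [eu ew ez ->].
  have {}eu := set1_inj eu; subst u'.
  rewrite argmin_w in ew; have {}ew := set1_inj ew; subst w'.
  rewrite argmin_z in ez; have {}ez := set1_inj ez; subst z'.
  by congr Iterate; rewrite multiplierE.
- by move=> -> /=; rewrite argmin_w argmin_z multiplierE.
Qed.

End OneStep.

Lemma admm_sequence_reduced (x : V) (v : nat -> iterate R n) :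
  admm_sequence p v -> starts_at x v ->
  forall k, reduced (v k) = iter k reduced_map x.
Proof.
move=> av [w0 z0 l0] k.
suff [e1 e2 e3] : [/\ itw (v k) = (iter k reduced_map x).1,
    itz (v k) = pos_part (iter k reduced_map x).2 &
    itl (v k) = neg_part (iter k reduced_map x).2].
  by rewrite /reduced e1 e2 e3 pos_neg_partK -surjective_pairing.
elim: k => [//|k [e1 e2 e3]].
by have := av k; rewrite (admm_step_reduced _ e1 e2 e3) => ->.
Qed.

Lemma admm_sequence_state (u : nat -> 'cV[R]_n) (x : nat -> V) :
  (forall k, x k.+1 = reduced_map (x k)) -> (forall k, u k.+1 = reduced_u (x k)) ->
  admm_sequence p (fun k => state_iterate (u k) (x k)).
Proof.
by move=> hx hu k; apply/(@admm_step_reduced (x k)) => //; rewrite hx hu.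
Qed.

Lemma reduced_state u x : reduced (state_iterate u x) = x.
Proof. by rewrite /reduced /= pos_neg_partK -surjective_pairing. Qed.

(** The KKT equations are the stationarity conditions of the three blocks with
    zero residual, so one step reproduces u, then w, then t. *)
Lemma kkt_point_fixed u x : kkt_point p (state_iterate u x) -> reduced_map x = x.
Proof.
case=> /= + + + _ _; rewrite A1 B1 trmx1 !mul1mx residualE => eu ew er.
have solve (Q : 'M[R]_n) (v v' : 'cV[R]_n) : posdef Q ->
    (Q + 1%:M) *m v = (Q + 1%:M) *m v' -> v = v'.
  by move=> pQ e; apply: (can_inj (mulKmx (posdef_unit (posdef_add1 pQ)))).
have uE : reduced_u x = u.
  apply: (solve _ _ _ pdx); rewrite reduced_uE mulmxDl mul1mx {1}eu.
  apply/eqP; rewrite -subr_eq0; apply/eqP; rewrite -[RHS]oppr0 -er.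
  by move: (pos_part _) => a; apply/colP => i; rewrite !mxE; ring.
have wE : (reduced_map x).1 = x.1.
  apply: (solve _ _ _ pdy); rewrite reduced_wE uE mulmxDl mul1mx {1}ew.
  apply/eqP; rewrite -subr_eq0; apply/eqP; rewrite -[RHS]oppr0 -er.
  by move: (pos_part _) => a; apply/colP => i; rewrite !mxE; ring.
rewrite [LHS]surjective_pairing [RHS]surjective_pairing wE; congr pair.
rewrite reduced_tE uE wE -[x.2 in RHS]pos_neg_partK; apply/eqP.
rewrite -subr_eq0; apply/eqP; rewrite -[RHS]oppr0 -er.
by move: (pos_part _) (neg_part _) => a c; apply/colP => i; rewrite !mxE; ring.
Qed.

End Admm.

(** * The change of variables *)

Section Transformed.
Context {R : realType} {n : nat}.

Lemma map_transformed (p : slack_qp rat n) :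
  map_qp (ratr : rat -> R) (transformed p) = transformed (map_qp ratr p).
Proof.
by rewrite /map_qp /transformed /= !map_mx1 !map_mxM -!matrix.map_trmx !map_invmx.
Qed.

Lemma quad_congr (A Q : 'M[R]_n) (c x : 'cV[R]_n) : A \in unitmx ->
  quad ((invmx A)^T *m Q *m invmx A) ((invmx A)^T *m c) (A *m x) = quad Q c x.
Proof.
move=> uA; rewrite /quad -!mulmxA (mulKmx uA).
have E v : dotv (A *m x) ((invmx A)^T *m v) = dotv x v.
  by rewrite dotv_mulmxl (mulmxA A^T) -trmx_mul mulVmx // trmx1 mul1mx.
by rewrite E (dotvC _ (A *m x)) E (dotvC c).
Qed.

Lemma equivalent_transformed (p : slack_qp R n) :
  mxA p \in unitmx -> mxB p \in unitmx ->
  equivalent_via (fun v => let: (x, y, z) := v in (mxA p *m x, mxB p *m y, z))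
    (program_of p) (program_of (transformed p)).
Proof.
move=> uA uB; split.
- exists (fun v => let: (x, y, z) := v in
                   (invmx (mxA p) *m x, invmx (mxB p) *m y, z)).
    by move=> [[x y] z]; rewrite !mulKmx.
  by move=> [[x y] z]; rewrite !mulKVmx.
- by move=> [[x y] z] /=; rewrite /residual /= !mul1mx.
- by move=> [[x y] z] /=; rewrite !quad_congr.
Qed.

Lemma posdef_transformed (A Q : 'M[R]_n) :
  posdef Q -> A \in unitmx -> posdef ((invmx A)^T *m Q *m invmx A).
Proof. by move=> pQ uA; apply: posdef_congr; rewrite ?unitmx_inv. Qed.

End Transformed.

(** * Matrices of order three *)

Section ThreeByThree.

Lemma ordS3 (i : 'I_3) : ordS (ordS (ordS i)) = i.
Proof. by apply: val_inj; case: i => [[|[|[|]]]]. Qed.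

Lemma sum3 (V : nmodType) (f : 'I_3 -> V) i :
  \sum_k f k = f i + f (ordS i) + f (ordS (ordS i)).
Proof.
have E : \sum_k f k = f ord0 + f (ordS ord0) + f (ordS (ordS ord0)).
  rewrite !big_ord_recl big_ord0 addr0 addrA.
  by congr (_ + f _ + f _); apply: val_inj.
have [->|->|->] : [\/ i = ord0, i = ordS ord0 | i = ordS (ordS ord0)].
  case: i => [[|[|[|//]]] hi]; [constructor 1|constructor 2|constructor 3];
  exact: val_inj.
- exact: E.
- by rewrite E !ordS3 -addrA addrC.
- by rewrite E !ordS3 addrC addrA.
Qed.

Lemma ordS3_cases (i j : 'I_3) : [\/ j = i, j = ordS i | j = ordS (ordS i)].
Proof.
case: i j => [[|[|[|//]]] hi] [[|[|[|//]]] hj];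
 by [constructor 1; apply: val_inj|constructor 2; apply: val_inj|constructor 3; apply: val_inj].
Qed.

Lemma ordS3_neq (i : 'I_3) : (i == ordS i) = false /\ (i == ordS (ordS i)) = false.
Proof. by split; case: i => [[|[|[|]]]]. Qed.

(** Cyclic successors absorb the signs of the cofactors, so the adjugate has one
    uniform formula that can also be evaluated on enclosures. *)
Definition adj3 (R : pzRingType) (M : 'M[R]_3) : 'M[R]_3 :=
  \matrix_(i, j) (M (ordS j) (ordS i) * M (ordS (ordS j)) (ordS (ordS i))
                  - M (ordS j) (ordS (ordS i)) * M (ordS (ordS j)) (ordS i)).

Definition det3 (R : pzRingType) (M : 'M[R]_3) : R := (M *m adj3 M) 0 0.

Lemma mulmx_adj3 (R : comPzRingType) (M : 'M[R]_3) :
  M *m adj3 M = (det3 M)%:M.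
Proof.
apply/matrixP => i j; rewrite /det3 !mxE !(sum3 _ ord0) !mxE !ordS3.
have [n1 n2] := ordS3_neq i.
have [->|->|->] := ordS3_cases i j; rewrite ?eqxx ?n1 ?n2 ?ordS3 ?mulr1n ?mulr0n; last 2 first.
- have [->|->|->] := ordS3_cases ord0 i; rewrite ?ordS3; ring.
- have [->|->|->] := ordS3_cases ord0 i; rewrite ?ordS3; ring.
have [->|->|->] := ordS3_cases ord0 i; rewrite ?ordS3; ring.
Qed.

Lemma invmx3 (F : fieldType) (M : 'M[F]_3) : det3 M != 0 ->
  M \in unitmx /\ invmx M = (det3 M)^-1 *: adj3 M.
Proof.
move=> d0; have e : M *m ((det3 M)^-1 *: adj3 M) = 1%:M.
  by rewrite -scalemxAr mulmx_adj3 scale_scalar_mx mulVf.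
have [uM _] := mulmx1_unit e; split => //.
by rewrite -[RHS](mulKmx uM) e mulmx1.
Qed.

(** Sylvester's criterion.  Multiplying the form by the product of the first two
    leading minors writes it as a combination of three squares whose coefficients
    are 1 and products of leading minors. *)
Lemma posdef3 (R : realType) (Q : 'M[R]_3) :
  Q^T = Q -> 0 < Q 0 0 -> 0 < adj3 Q (ordS (ordS 0)) (ordS (ordS 0)) -> 0 < det3 Q ->
  posdef Q.
Proof.
move=> sQ; have s i j : Q i j = Q j i by rewrite -{1}sQ mxE.
rewrite /det3 !mxE !(sum3 _ ord0) !mxE !ordS3; set b := ordS ord0; set c := ordS b.
rewrite (_ : 0 = ord0) //.
rewrite (s b ord0) (s c ord0) (s c b).
move=> a0 m0 d0; split=> // x x0; rewrite dotvE (sum3 _ ord0) !mxE !(sum3 _ ord0).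
rewrite -/b -/c (s b ord0) (s c ord0) (s c b).
have {x0} : [|| x ord0 0 != 0, x b 0 != 0 | x c 0 != 0].
  apply: contraNT x0; rewrite !negb_or !negbK => /and3P[/eqP e0 /eqP e1 /eqP e2].
  by apply/eqP/colP => i; rewrite mxE; have [->|->|->] := ordS3_cases ord0 i.
move: (x ord0 0) (x b 0) (x c 0) a0 m0 d0 => y1 y2 y3.
move: (Q ord0 ord0) (Q ord0 b) (Q ord0 c) (Q b b) (Q b c) (Q c c).
move=> a11 a12 a13 a22 a23 a33 a0 m0 d0 y0.
set m := a11 * a22 - a12 * a12 in m0; set d := (X in 0 < X) in d0.
set q := (X in 0 < X).
(* Two successive completions of squares, with denominators cleared. *)
have E : a11 * m * q = m * (a11 * y1 + a12 * y2 + a13 * y3) ^+ 2 +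
    (m * y2 + (a11 * a23 - a12 * a13) * y3) ^+ 2 + a11 * d * y3 ^+ 2.
  by rewrite /q /d /m; ring.
have am : 0 < a11 * m by rewrite mulr_gt0.
rewrite -(pmulr_rgt0 _ am) E; have [z3|z3] := eqVneq y3 0; last first.
  apply: ltr_wpDl; last by rewrite (mulr_gt0 (mulr_gt0 a0 d0)) // exprn_even_gt0.
  by apply: addr_ge0; rewrite ?sqr_ge0 // (mulr_ge0 (ltW m0)) // sqr_ge0.
move: y0; rewrite z3 !mulr0 !addr0 expr0n /= mulr0 addr0 eqxx orbF.
have [z2|z2 _] := eqVneq y2 0; last first.
  apply: ltr_wpDl; first by rewrite (mulr_ge0 (ltW m0)) // sqr_ge0.
  by rewrite exprn_even_gt0 //= mulf_neq0 // gt_eqF.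
rewrite orbF z2 !mulr0 !addr0 expr0n addr0 => z1.
by rewrite mulr_gt0 // exprn_even_gt0 //= mulf_neq0 // gt_eqF.
Qed.

End ThreeByThree.

(** * Norms and affine fixed points on the state space *)

Section StateNorm.
Context {R : realType} {n : nat}.

Lemma norm_coord_le (x : 'cV[R]_n) i : `|x i 0| <= `|x|.
Proof.
rewrite /Num.norm /= mx_normrE.
by apply: le_trans (le_bigmax _ _ (i, 0 : 'I_1)).
Qed.

Lemma norm_cV_le (x : 'cV[R]_n) c :
  0 <= c -> (forall i, `|x i 0| <= c) -> `|x| <= c.
Proof.
move=> c0 h; rewrite /Num.norm /= mx_normrE; apply: bigmax_le => // -[i j] _ /=.
by rewrite (ord1 j).
Qed.

Local Notation V := ('cV[R]_n * 'cV[R]_n)%type.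

Lemma norm_state_le (x : V) c : `|x| <= c <-> `|x.1| <= c /\ `|x.2| <= c.
Proof.
by rewrite prod_normE ge_max; split => [/andP|] // [-> ->].
Qed.

Definition unit_state (b : bool) (i : 'I_n) : V :=
  if b then (delta_mx i 0, 0) else (0, delta_mx i 0).

Lemma linear_stateE (f : V -> V) : linear f ->
  forall v, f v = \sum_i v.1 i 0 *: f (unit_state true i) +
                  \sum_i v.2 i 0 *: f (unit_state false i).
Proof.
move=> lf v.
pose g : {linear V -> V} := HB.pack f (GRing.isLinear.Build _ _ _ _ f lf).
have fD u w : f (u + w) = f u + f w by exact: (linearD g).
have fZ a u : f (a *: u) = a *: f u by exact: (linearZ_LR g).
have fS (F : 'I_n -> V) : f (\sum_i F i) = \sum_i f (F i) by exact: (linear_sum g).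
have vE : v = \sum_i v.1 i 0 *: unit_state true i +
              \sum_i v.2 i 0 *: unit_state false i.
  have dE (x : 'cV[R]_n) : x = \sum_i x i 0 *: delta_mx i 0.
    by rewrite {1}[x]matrix_sum_delta; apply: eq_bigr => i _; rewrite big_ord1.
  have -> : v = (v.1, 0) + (0, v.2) :> V.
    by rewrite -[RHS]/(v.1 + 0, 0 + v.2) addr0 add0r -surjective_pairing.
  rewrite [v.1 in LHS]dE [v.2 in LHS]dE; congr (_ + _) => /=.
    rewrite (big_morph (fun x => (x, 0) : V) (id1 := 0) (op1 := +%R)) //; last first.
      by move=> x y; rewrite -[RHS]/(_ + _, 0 + 0) addr0.
    apply: eq_bigr => i _.
    by rewrite -[RHS]/(_ *: delta_mx i 0, _ *: 0) scaler0 addr0.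
  rewrite (big_morph (fun x => (0, x) : V) (id1 := 0) (op1 := +%R)) //; last first.
    by move=> x y; rewrite -[RHS]/(0 + 0, _ + _) addr0.
  apply: eq_bigr => i _.
  by rewrite -[RHS]/(_ *: 0, _ *: delta_mx i 0) scaler0 add0r.
rewrite {1}vE fD !fS; congr (_ + _); apply: eq_bigr => i _; exact: fZ.
Qed.

(** In the sup norm, a linear map is bounded by the sum of the norms of its
    columns, a quantity that needs only finitely many evaluations. *)
Lemma norm_linear_le (f : V -> V) : linear f ->
  forall v, `|f v| <= (\sum_b \sum_i `|f (unit_state b i)|) * `|v|.
Proof.
move=> lf v; rewrite {1}(linear_stateE lf) big_bool /= mulrDl !mulr_suml.
have [h1 h2] := (norm_state_le v _).1 (lexx _).
apply: le_trans (ler_normD _ _) _.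
apply: lerD; apply: le_trans (ler_norm_sum _ _ _) _; apply: ler_sum => i _;
  rewrite normrZ mulrC ler_wpM2l //.
  exact: le_trans (norm_coord_le _ _) h1.
exact: le_trans (norm_coord_le _ _) h2.
Qed.

(** In finite dimension, injectivity of 1 - L implies surjectivity. *)
Lemma affine_fixpoint (T L : V -> V) : linear L ->
  (forall y z, T y - T z = L (y - z)) -> (forall v, L v = v -> v = 0) ->
  exists x, T x = x.
Proof.
move=> lL TL L1.
pose g : {linear V -> V} := HB.pack L (GRing.isLinear.Build _ _ _ _ L lL).
pose h : 'Hom(V, V) := linfun (@idfun V \- g).
have hE v : h v = v - L v by rewrite lfunE.
have h0 : lker h == 0%VS.
  apply/lker0P => a b; rewrite !hE => eab; apply/eqP; rewrite -subr_eq0; apply/eqP.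
  apply: L1; have -> : L (a - b) = L a - L b by exact: (linearB g).
  have ea : a = b + (L a - L b) by rewrite (addrC (L a)) addrA -eab subrK.
  by rewrite [X in _ = X - _]ea [RHS]addrAC subrr add0r.
pose x := (h^-1%VF) (T 0); exists x.
have : x - L x = T 0 by rewrite -hE (lker0_lfunVK h0).
by move=> ex; rewrite -[LHS](subrK (T 0)) TL subr0 -ex addrC subrK.
Qed.

End StateNorm.

(** * Attracting cycles of locally affine maps *)

Section Cycle.
Context {R : realType} {V : normedModType R}.
Implicit Types (L : V -> V) (v : V).

(** Contraction of one power suffices: blocks of m iterations contribute the
    factor q, and at most m - 1 remaining iterations the factor K^m. *)
Lemma iter_linear_le L (K q : R) m : (0 < m)%N -> 1 <= K -> 0 <= q ->
  (forall v, `|L v| <= K * `|v|) ->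
  (forall v, `|iter m L v| <= q * `|v|) ->
  forall l v, `|iter l L v| <= K ^+ m * q ^+ (l %/ m) * `|v|.
Proof.
move=> m0 K1 q0 hK hq l v; have K0 := le_trans ler01 K1.
have hKr r u : `|iter r L u| <= K ^+ r * `|u|.
  elim: r => [|r IH]; first by rewrite mul1r.
  by rewrite iterS exprS -mulrA (le_trans (hK _)) // ler_wpM2l.
have hqd d u : `|iter (d * m) L u| <= q ^+ d * `|u|.
  elim: d => [|d IH]; first by rewrite mul1r.
  by rewrite mulSn iterD exprS -mulrA (le_trans (hq _)) // ler_wpM2l.
rewrite {1}(divn_eq l m) addnC iterD.
apply: le_trans (hKr _ _) _; rewrite -mulrA ler_pM ?exprn_ge0 //.
by rewrite ler_weXn2l // ltnW // ltn_mod.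
Qed.

(** The map F agrees near the j-th point of the orbit of x0 with G j, which is
    affine with linear part D j.  Only a power of the linear part of the whole
    cycle is assumed to contract; the cycle itself may expand. *)
Section Orbit.
Context (F : V -> V) (N : nat) (G D : nat -> V -> V) (x0 : V).
Context (C q mu : R) (m : nat).
Hypothesis affine : forall j y z, G j y - G j z = D j (y - z).
Hypothesis periodic : iteri N G x0 = x0.
Hypothesis mu_gt0 : 0 < mu.
Hypothesis local : forall j, (j < N)%N -> forall y,
  `|y - iteri j G x0| < mu -> F y = G j y.
Hypothesis C_ge1 : 1 <= C.
Hypothesis bounded : forall j, (j <= N)%N -> forall v, `|iteri j D v| <= C * `|v|.
Hypothesis m_gt0 : (0 < m)%N.
Hypothesis q_lt1 : 0 <= q < 1.
Hypothesis contracting : forall v, `|iter m (iteri N D) v| <= q * `|v|.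

Let addrBK (a b : V) : a + b - a = b.
Proof. by rewrite addrAC subrr add0r. Qed.

Lemma iteri_affine j y z : iteri j G y - iteri j G z = iteri j D (y - z).
Proof. by elim: j => //= j <-; rewrite affine. Qed.

Let L := iteri N D.
Let C_ge0 : 0 <= C. Proof. exact: le_trans C_ge1. Qed.

Lemma power_le l v : `|iter l L v| <= C ^+ m * q ^+ (l %/ m) * `|v|.
Proof.
have /andP[q0 _] := q_lt1.
by apply: iter_linear_le => // u; apply: bounded.
Qed.

(** Along the orbit of a state at distance d from x0, the distance to the cycle
    never exceeds C C^m d, which has to stay below mu. *)
Definition basin_radius := mu / (C * C ^+ m).

Lemma basin_radius_gt0 : 0 < basin_radius.
Proof. by rewrite divr_gt0 // mulr_gt0 // ?exprn_gt0 // (lt_le_trans _ C_ge1). Qed.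

Lemma orbit_le y l j : (j <= N)%N ->
  `|iteri j D (iter l L (y - x0))| <= C * C ^+ m * q ^+ (l %/ m) * `|y - x0|.
Proof.
move=> jN; apply: le_trans (bounded jN _) _.
by rewrite -!mulrA ler_wpM2l // mulrA power_le.
Qed.

Lemma basin_orbit y l j : `|y - x0| < basin_radius -> (j <= N)%N ->
  iter (N * l + j) F y = iteri j G x0 + iteri j D (iter l L (y - x0)).
Proof.
move=> yd; have /andP[q0 /ltW q1] := q_lt1.
(* Within one period, a state at distance less than mu / C sees these branches. *)
have E z k : (k <= N)%N -> `|z - x0| < mu / C ->
    iter k F z = iteri k G x0 + iteri k D (z - x0).
  move=> + zd; elim: k => [_|k IH kN] /=; first by rewrite addrC subrK.
  rewrite (IH (ltnW kN)) -iteri_affine addrC subrK (local kN).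
    by rewrite -affine addrC subrK.
  rewrite iteri_affine; apply: le_lt_trans (bounded (ltnW kN) _) _.
  by rewrite mulrC -ltr_pdivlMr // (lt_le_trans _ C_ge1).
(* No power of L moves the state out of that neighborhood. *)
have bd i : `|iter i L (y - x0)| < mu / C.
  apply: le_lt_trans (power_le _ _) _.
  apply: le_lt_trans (_ : C ^+ m * `|y - x0| < _).
    by rewrite ler_wpM2r // ler_piMr ?exprn_ge0 // exprn_ile1.
  rewrite mulrC -ltr_pdivlMr ?exprn_gt0 ?(lt_le_trans _ C_ge1) //.
  by rewrite -mulrA -invfM.
have I i : iter (N * i) F y = x0 + iter i L (y - x0).
  elim: i => [|i IH]; first by rewrite muln0 addrC subrK.
  rewrite mulnS iterD IH E //; last by rewrite addrBK.
  by rewrite periodic addrBK.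
by move=> jN; rewrite addnC iterD I E // addrBK.
Qed.

Lemma iter_cycle j : (j <= N)%N -> iter j F x0 = iteri j G x0.
Proof.
move=> jN; have := @basin_orbit x0 0 j; rewrite subrr normr0 basin_radius_gt0 muln0.
move=> ->//=; rewrite -[X in iteri j D X](subrr x0) -iteri_affine subrr addr0 //.
Qed.

Lemma cycle_attracting y j : `|y - x0| < basin_radius -> (j < N)%N ->
  iter (N * l + j) F y @[l --> \oo] --> iter j F x0.
Proof.
move=> yd jN; rewrite iter_cycle ?(ltnW jN) //; have /andP[q0 q1] := q_lt1.
have E : (fun l => iter (N * l + j) F y) =
  (fun l => iteri j G x0 + iteri j D (iter l L (y - x0))).
  by apply/funext => l; rewrite basin_orbit // ltnW.
rewrite E -[X in _ --> X]addr0; apply: cvgD; first exact: cvg_cst.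
apply/norm_cvg0P.
have z0 : (fun l => C * C ^+ m * q ^+ (l %/ m) * `|y - x0|) @ \oo --> (0 : R).
  have qm : (fun l => q ^+ (l %/ m)) @ \oo --> (0 : R).
    apply: (@cvg_comp _ _ _ (fun l => l %/ m)%N (fun l => q ^+ l) _ \oo).
      apply/cvgnyPge => A; exists (A * m)%N => //= l /= Al.
      by rewrite leq_divRL.
    by apply: cvg_expr; rewrite ger0_norm.
  rewrite -(mulr0 (C * C ^+ m)) -(mul0r `|y - x0|).
  by rewrite mulrA; apply: cvgMr_tmp; apply: cvgMl_tmp.
apply: (squeeze_cvgr _ (cvg_cst 0) z0).
by near=> l; rewrite normr_ge0 orbit_le // ltnW.
Unshelve. all: by end_near.
Qed.

End Orbit.
End Cycle.

(** A smaller period would be coprime to N, and Bezout would make 1 a period. *)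
Lemma minimal_period_prime (X : Type) N (s : nat -> X) : prime N ->
  (forall k, s (k + N)%N = s k) -> s 1%N <> s 0%N -> minimal_period N s.
Proof.
move=> pN sN s10; split=> // [|m /andP[m0 mN] sm]; first exact: prime_gt0.
have mul d j i : (forall k, s (k + d)%N = s k) -> s (i + j * d)%N = s i.
  by move=> sd; elim: j => [|j IH]; rewrite ?addn0 // mulSn addnCA addnC sd.
have cop : coprime m N by rewrite coprime_sym prime_coprime // gtnNdvd.
have [u v e _] := egcdnP N m0; apply: s10.
by rewrite -(mul N v 1%N sN) addnC -(eqP cop) -e -[(u * m)%N]add0n mul.
Qed.

(** Telescoping e - L^m e into the images L^i r, i < m, bounds it by
    (1 + c + ... + c^(m-1)) |r|; the iterate is this sum in Horner form. *)
Lemma near_fixpoint_le (R : realType) (V : normedModType R) (L : V -> V) m (c q : R) (e r : V) :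
  (forall u v, L u - L v = L (u - v)) -> (forall v, `|L v| <= c * `|v|) ->
  (forall v, `|iter m L v| <= q * `|v|) -> 0 <= c -> e - L e = r ->
  (1 - q) * `|e| <= iter m (fun a => 1 + c * a) 0 * `|r|.
Proof.
move=> LB Lc Lq c0 er.
have H k : `|e - iter k L e| <= iter k (fun a => 1 + c * a) 0 * `|r|.
  elim: k => [|k IH] /=; first by rewrite subrr normr0 mul0r.
  have -> : e - L (iter k L e) = r + L (e - iter k L e) by rewrite -LB -er addrA subrK.
  apply: le_trans (ler_normD _ _) _; rewrite mulrDl mul1r lerD2l.
  by rewrite -mulrA; apply: le_trans (Lc _) _; apply: ler_wpM2l.
have := H m; have := Lq e; have := ler_normD (e - iter m L e) (iter m L e).
by rewrite subrK; lra.
Qed.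

(** * Cycles that follow an itinerary of signs *)

Section BranchLinear.
Context {R : comPzRingType} {n : nat}.
Local Notation V := ('cV[R]_n * 'cV[R]_n)%type.

Lemma branch_affine (K1 K2 : 'M[R]_n) b g1 g2 s (x y : V) :
  branch K1 K2 b g1 g2 s x - branch K1 K2 b g1 g2 s y =
  branch K1 K2 0 0 0 s (x - y).
Proof.
have aB : signed_abs s (x - y).2 = signed_abs s x.2 - signed_abs s y.2.
  by apply/colP => i; rewrite !mxE; case: (s i); ring.
have nB : signed_neg s (x - y).2 = signed_neg s x.2 - signed_neg s y.2.
  by apply/colP => i; rewrite !mxE; case: (s i); ring.
have uB : branch_u K1 b g1 s x - branch_u K1 b g1 s y = branch_u K1 0 0 s (x - y).
  rewrite /branch_u aB -[(x - y).1]/(x.1 - y.1) subr0.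
  rewrite opprB addrA subrK -mulmxBr; congr (_ *m _).
  by apply/colP => i; rewrite !mxE; ring.
have wB u v : K2 *m (b - signed_abs s x.2 - u) - g2 - (K2 *m (b - signed_abs s y.2 - v) - g2)
    = K2 *m (0 - signed_abs s (x - y).2 - (u - v)) - 0.
  rewrite aB subr0 opprB addrA subrK -mulmxBr; congr (_ *m _).
  by apply/colP => i; rewrite !mxE; ring.
rewrite /branch -uB -wB nB -[LHS]/(_ - _, _ - _) /=; congr pair.
move: (branch_u _ _ _ _ x) (branch_u _ _ _ _ y) => u v.
move: (_ - g2) (_ - g2) => w w'.
by apply/colP => i; rewrite !mxE; ring.
Qed.

Lemma branch_linear (K1 K2 : 'M[R]_n) s : linear (branch K1 K2 0 0 0 s : V -> V).
Proof.
move=> a x y.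
have aL : signed_abs s (a *: x + y).2 = a *: signed_abs s x.2 + signed_abs s y.2.
  by apply/colP => i; rewrite !mxE; case: (s i); ring.
have nL : signed_neg s (a *: x + y).2 = a *: signed_neg s x.2 + signed_neg s y.2.
  by apply/colP => i; rewrite !mxE; case: (s i); ring.
have uL : branch_u K1 0 0 s (a *: x + y) = a *: branch_u K1 0 0 s x + branch_u K1 0 0 s y.
  rewrite /branch_u aL -[(a *: x + y).1]/(a *: x.1 + y.1) !subr0.
  rewrite scalemxAr -mulmxDr; congr (_ *m _).
  move: (signed_abs _ x.2) (signed_abs _ y.2) => a1 a2.
  by apply/colP => i; rewrite !mxE; ring.
rewrite /branch uL nL aL -[RHS]/(a *: _ + _, a *: _ + _) /=.
have -> (u v : 'cV_n) : K2 *m (0 - (a *: signed_abs s x.2 + signed_abs s y.2) - (a *: u + v)) - 0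
   = a *: (K2 *m (0 - signed_abs s x.2 - u) - 0) + (K2 *m (0 - signed_abs s y.2 - v) - 0).
  rewrite !subr0 scalemxAr -mulmxDr; congr (_ *m _).
  by apply/colP => i; rewrite !mxE; ring.
congr pair.
move: (branch_u _ _ _ _ x) (branch_u _ _ _ _ y) => u v.
move: (_ - 0) (_ - 0) => w w'.
by apply/colP => i; rewrite !mxE; ring.
Qed.

End BranchLinear.

Lemma iteri_linear (R : pzRingType) (V : lmodType R) (D : nat -> V -> V) k :
  (forall j, linear (D j)) -> linear (iteri k D).
Proof. by move=> lD; elim: k => [//|k IH] a x y; rewrite /= IH lD. Qed.

Section Itineraries.
Context {R : realType}.
Local Notation V := ('cV[R]_3 * 'cV[R]_3)%type.
Context (itinerary : seq (seq bool)).

Definition sign_at j : 'I_3 -> bool := fun i => nth true (nth [::] itinerary j) i.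

(** The margin is what makes the choice of branch stable under perturbation. *)
Definition signs_margin (mu : R) (s : 'I_3 -> bool) (x : V) :=
  forall i, if s i then mu <= x.2 i 0 else x.2 i 0 <= - mu.

Definition itinerary_branch (K1 K2 : 'M[R]_3) b g1 g2 j : V -> V :=
  branch K1 K2 b g1 g2 (sign_at j).

End Itineraries.

Section CycleOfItinerary.
Context {R : realType} (p : slack_qp R 3).
Hypotheses (A1 : mxA p = 1%:M) (B1 : mxB p = 1%:M).
Hypotheses (pdx : posdef (hessx p)) (pdy : posdef (hessy p)).
Local Notation V := ('cV[R]_3 * 'cV[R]_3)%type.
Context (itinerary : seq (seq bool)) (x0 : V) (mu q : R) (m : nat).
Local Notation N := (size itinerary).
Local Notation G := (itinerary_branch itinerary (resx p) (resy p) (rhs p)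
  (resx p *m linx p) (resy p *m liny p)).
Local Notation D := (itinerary_branch itinerary (resx p) (resy p) 0 0 0).
Local Notation F := (reduced_map p).
Hypotheses (N_prime : prime N) (mu_gt0 : 0 < mu) (m_gt0 : (0 < m)%N) (q_lt1 : 0 <= q < 1).
Hypothesis periodic : iteri N G x0 = x0.
Hypothesis margin : forall j, (j < N)%N -> signs_margin mu (sign_at itinerary j) (iteri j G x0).
Hypothesis contracting : forall v, `|iter m (iteri N D) v| <= q * `|v|.
Hypothesis nonconstant : exists j k i, [/\ (j < N)%N, (k < N)%N &
  sign_at itinerary j i <> sign_at itinerary k i].

Let affine j y z : G j y - G j z = D j (y - z).
Proof. exact: branch_affine. Qed.

Let local j : (j < N)%N -> forall y, `|y - iteri j G x0| < mu -> F y = G j y.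
Proof.
move=> jN y yj; rewrite /reduced_map /reduced_branch (_ : state_signs y = sign_at itinerary j) //.
apply/funext => i; have := margin jN i.
have : `|(y - iteri j G x0).2 i 0| < mu.
  apply: le_lt_trans yj; apply: le_trans (norm_coord_le _ _) _.
  exact: ((norm_state_le _ _).1 (lexx _)).2.
rewrite /state_signs -[(y - _).2]/(y.2 - _.2) !mxE ltr_norml => /andP[l1 l2].
by case: ifP => _ h; [apply/idP|apply/negbTE; rewrite -ltNge]; lra.
Qed.

Let bounded : exists2 C : R, 1 <= C &
  forall j, (j <= N)%N -> forall v, `|iteri j D v| <= C * `|v|.
Proof.
pose c j : R := \sum_b \sum_i `|iteri j D (unit_state b i)|.
have c0 j : 0 <= c j by rewrite sumr_ge0 // => b _; rewrite sumr_ge0.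
exists (1 + \sum_(j < N.+1) c j); first by rewrite lerDl sumr_ge0.
move=> j jN v; have lj : linear (iteri j D).
  by apply: iteri_linear => k; apply: branch_linear.
apply: le_trans (norm_linear_le lj v) _.
apply: ler_wpM2r => //; rewrite (bigD1 (Ordinal (jN : (j < N.+1)%N))) //= addrCA.
by rewrite -/(c j) lerDl addr_ge0 // sumr_ge0.
Qed.

Let X k := iter k F x0.

(** The u-component of an iterate is determined by the preceding state, here the
    one N - 1 steps later in the cycle. *)
Theorem itinerary_cycle : exists s : nat -> iterate R 3, attracting_nonKKT_cycle p N s.
Proof.
have [C C1 hC] := bounded.
have N0 : (0 < N)%N := prime_gt0 N_prime.
have XG j : (j <= N)%N -> X j = iteri j G x0.
  by move=> jN; exact: (iter_cycle affine periodic mu_gt0 local C1 hC m_gt0 q_lt1 contracting jN).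
have XN k : X (k + N)%N = X k by rewrite /X iterD -/(X N) XG // periodic.
have XMN k i : X (i + k * N)%N = X i.
  by elim: k => [|k IH]; rewrite ?addn0 // mulSn addnCA addnC XN.
(* A fixed point would satisfy the sign conditions of all phases at once. *)
have X10 : X 1%N <> X 0%N.
  move=> e; have {}e k : X k = x0.
    elim: k => [|k IH]; first by [].
    by rewrite /X iterS -/(X k) IH; exact: e.
  have [j [k [i [jN kN]]]] := nonconstant; apply.
  have := margin jN i; have := margin kN i.
  rewrite -(XG _ (ltnW jN)) -(XG _ (ltnW kN)) !e; move: (x0.2 i 0) => t h1 h2.
  have absurd : mu <= t -> t <= - mu -> False.
    move=> a b; have := lt_le_trans mu_gt0 (le_trans a b).
    by rewrite oppr_gt0 ltNge ltW.
  by move: h1 h2; case: (sign_at _ k i); case: (sign_at _ j i) => // h1 h2; case: absurd.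
pose s k := state_iterate (reduced_u p (X (k + N.-1)%N)) (X k).
have rs k : reduced (s k) = X k by exact: reduced_state.
exists s; split.
- apply: admm_sequence_state => // k.
  by rewrite addSnnS prednK // XN.
- apply: minimal_period_prime => // [k|/(congr1 (@reduced R 3))].
    by rewrite /s XN addnAC XN.
  by rewrite !rs.
- apply: minimal_period_prime => // [k|]; first by rewrite !rs XN.
  by rewrite !rs.
- exists [set x | `|x - x0| < basin_radius C mu m]; split.
  + have -> : [set x | `|x - x0| < basin_radius C mu m] = ball x0 (basin_radius C mu m).
      by rewrite -ball_normE; apply/funext => x; rewrite /= distrC.
    by apply: ball_open; apply: basin_radius_gt0.
  + by rewrite /= rs subrr normr0; apply: basin_radius_gt0.
  + move=> x /= xd; split.
      pose u k := if k is k'.+1 then reduced_u p (iter k' F x) else 0.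
      exists (fun k => state_iterate (u k) (iter k F x)); split => //.
      exact: admm_sequence_state.
    move=> v av sv j jN; rewrite rs.
    under eq_fun do rewrite (admm_sequence_reduced A1 B1 pdx pdy av sv).
    exact: (cycle_attracting affine periodic mu_gt0 local C1 hC m_gt0 q_lt1 contracting).
- move=> k /(kkt_point_fixed A1 B1 pdx pdy) fX; apply: X10.
  (* The orbit is constant from phase k on, hence everywhere by periodicity. *)
  have const i : X (i + k)%N = X k.
    elim: i => [|i IH]; first by rewrite add0n.
    by rewrite addSn /X iterS -/(X (i + k)%N) IH; exact: fX.
  have kN : (k <= k * N)%N by rewrite leq_pmulr.
  rewrite -(XMN k 1%N) -(XMN k 0%N) -(subnK kN) !addnA.
  by rewrite (const (1 + _)%N) (const (0 + _)%N).
Qed.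

End CycleOfItinerary.

(** * Ball arithmetic on integers *)

Import BinInt.
Delimit Scope nat_scope with N.

Local Arguments Z.shiftr : simpl never.
Local Arguments Z.div : simpl never.
Local Arguments Z.mul : simpl never.
Local Arguments Z.add : simpl never.

Section IntegerValues.
Context {R : numDomainType}.

(** The value of a binary integer; computations are carried out on [Z], and this
    ring morphism transfers them to the reals. *)
Definition zr (z : Z) : R := (int_of_Z z)%:~R.

Lemma zrD a b : zr (a + b)%Z = zr a + zr b.
Proof. by rewrite /zr (rmorphD int_of_Z) intrD. Qed.

Lemma zrN a : zr (- a)%Z = - zr a.
Proof. by rewrite /zr (rmorphN int_of_Z) intrN. Qed.

Lemma zrM a b : zr (a * b)%Z = zr a * zr b.
Proof. by rewrite /zr (rmorphM int_of_Z) intrM. Qed.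

Lemma zr_le a b : (a <= b)%Z -> zr a <= zr b.
Proof. by move=> h; rewrite /zr ler_int; lia. Qed.

Lemma zr_lt a b : (a < b)%Z -> zr a < zr b.
Proof. by move=> h; rewrite /zr ltr_int; lia. Qed.

Lemma zr_abs a : zr (Z.abs a) = `|zr a|.
Proof. by rewrite /zr -intr_norm; congr (_%:~R); lia. Qed.

End IntegerValues.
Arguments zr R z : clear implicits.

Lemma zr0 (R : numDomainType) : zr R 0 = 0. Proof. by []. Qed.
Lemma zr1 (R : numDomainType) : zr R 1 = 1. Proof. by []. Qed.
Lemma zr2 (R : numDomainType) : zr R 2 = 2. Proof. by []. Qed.

Section Ball.
Context (prec : positive).

Definition scale : Z := Z.pow 2 (Zpos prec).

Lemma scale_gt0 : (0 < scale)%Z.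
Proof. exact: Z.pow_pos_nonneg. Qed.

Lemma shiftr_scale a : Z.shiftr a (Zpos prec) = (a / scale)%Z.
Proof. by rewrite Z.shiftr_div_pow2. Qed.

(** A pair (m, r) encloses the reals at distance at most r / 2^prec from
    m / 2^prec.  Multiplication and division round the center down, and the
    radius pays for it. *)
Definition zball := (Z * Z)%type.
Definition badd (x y : zball) : zball := ((x.1 + y.1)%Z, (x.2 + y.2)%Z).
Definition bopp (x : zball) : zball := ((- x.1)%Z, x.2).
(** The radius of a product before rounding is |m| r' + |m'| r + r r'.  The
    truncations of the center and of the radius cost at most one unit each. *)
Definition bmul (x y : zball) : zball :=
  (Z.shiftr (x.1 * y.1) (Zpos prec),
   (Z.shiftr (Z.abs x.1 * y.2 + Z.abs y.1 * x.2 + x.2 * y.2) (Zpos prec) + 2)%Z).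
(** Meant for m > r: with X = 2^prec x in [m - r, m + r], the scaled inverse
    4^prec / X differs from 4^prec / m by at most 4^prec r / ((m - r) m). *)
Definition binv (x : zball) : zball :=
  ((scale * scale / x.1)%Z,
   (scale * scale * x.2 / ((x.1 - x.2) * x.1) + 2)%Z).
Definition bdiv (a b : Z) : zball := ((a * scale / b)%Z, 1%Z).

Context {R : realFieldType}.
Implicit Types (x y : R) (X Y : zball).
Local Notation S := (zr R scale).

Definition in_ball x X := `|x * S - zr R X.1| <= zr R X.2.

Lemma S_gt0 : 0 < S. Proof. by rewrite -zr0; apply/zr_lt/scale_gt0. Qed.

Lemma zr_divl a b : (0 < b)%Z -> zr R (a / b)%Z * zr R b <= zr R a.
Proof.
by move=> b0; rewrite -zrM; apply: zr_le; rewrite Z.mul_comm; apply: Z.mul_div_le.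
Qed.

Lemma zr_divr a b : (0 < b)%Z -> zr R a < (zr R (a / b)%Z + 1) * zr R b.
Proof.
move=> b0; rewrite -zr1 -zrD -zrM; apply: zr_lt; rewrite Z.mul_comm.
by rewrite Z.add_1_r; apply: Z.mul_succ_div_gt.
Qed.

Lemma in_ballD x y X Y : in_ball x X -> in_ball y Y -> in_ball (x + y) (badd X Y).
Proof.
rewrite /in_ball /= !zrD => hx hy.
apply: le_trans (lerD hx hy); apply: le_trans (ler_normD _ _).
by rewrite le_eqVlt; apply/orP; left; apply/eqP; congr (`|_|); ring.
Qed.

Lemma in_ballN x X : in_ball x X -> in_ball (- x) (bopp X).
Proof. by rewrite /in_ball /= !zrN mulNr -opprD normrN. Qed.

Lemma in_ball_ge0 x X : in_ball x X -> 0 <= zr R X.2.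
Proof. exact: le_trans. Qed.

Lemma in_ballM x y X Y : in_ball x X -> in_ball y Y -> in_ball (x * y) (bmul X Y).
Proof.
case: X Y => [m r] [m' r'] hx hy.
have := in_ball_ge0 hx; have := in_ball_ge0 hy; move: hx hy.
rewrite /in_ball /bmul /= !shiftr_scale !zrD !zr2.
have := zr_divl (m * m') scale_gt0; have := zr_divr (m * m') scale_gt0.
set e := (_ + _ + _)%Z; have := zr_divr e scale_gt0; have S0 := S_gt0.
rewrite {1}/e !zrD !zrM !zr_abs.
move: (zr R (e / scale)) (zr R (m * m' / scale)) S S0 => E Q s s0.
move: (zr R m) (zr R m') (zr R r) (zr R r') => {e}m {}m' {}r {}r' hE hQ1 hQ2 hx hy r'0 r0.
rewrite -(ler_pM2r s0) -[X in _ * X <= _](gtr0_norm s0) -normrM.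
have -> : (x * y * s - Q) * s = m * (y * s - m') + m' * (x * s - m)
   + (x * s - m) * (y * s - m') + (m * m' - Q * s) by ring.
have h4 : `|m * m' - Q * s| <= s by rewrite ger0_norm; lra.
have h1 : `|m * (y * s - m')| <= `|m| * r' by rewrite normrM ler_wpM2l.
have h2 : `|m' * (x * s - m)| <= `|m'| * r by rewrite normrM ler_wpM2l.
have h3 : `|(x * s - m) * (y * s - m')| <= r * r' by rewrite normrM ler_pM.
do 3 ![apply: le_trans (ler_normD _ _) _; rewrite -lerBrDr].
by lra.
Qed.

Lemma in_ballV x X : in_ball x X -> (X.2 <? X.1)%Z -> in_ball x^-1 (binv X).
Proof.
case: X => [m r] hx /= /Z.ltb_lt rm; have r0 := in_ball_ge0 hx; move: hx.
rewrite /in_ball /binv /= in r0 *; rewrite !zrD !zr2.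
have rZ : (0 <= r)%Z.
  by apply/Z.nlt_ge => /(@zr_lt R); rewrite zr0 ltNge r0.
have m0 : (0 < m)%Z by apply: Z.le_lt_trans rm.
have d0 : (0 < (m - r) * m)%Z by apply: Z.mul_pos_pos => //; apply/Z.lt_0_sub.
have := zr_divl (scale * scale) m0; have := zr_divr (scale * scale) m0.
have := zr_divr (scale * scale * r) d0; have S0 := S_gt0.
rewrite !zrM !zrD !zrN.
have := @zr_lt R _ _ m0; have := @zr_lt R _ _ rm; rewrite zr0.
move: (zr R (_ / (_ * _))) (zr R (_ / m)) S S0 => E Q s s0 {d0 rZ rm}.
move: (zr R m) (zr R r) r0 => {m0}m {}r r0 rm m0 hE hQ1 hQ2 hx.
have xs : m - r <= x * s by move: hx; rewrite ler_norml => /andP[]; lra.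
have x0 : 0 < x by rewrite -(pmulr_lgt0 _ s0); lra.
rewrite -(ler_pM2r (mulr_gt0 x0 m0)) -[X in _ * X <= _](gtr0_norm (mulr_gt0 x0 m0)) -normrM.
have -> : (x^-1 * s - Q) * (x * m) = (m - x * s) * s + (s * s - Q * m) * x.
  by field; rewrite gt_eqF.
have E1 : 0 < E + 1.
  have mr : 0 < (m - r) * m by rewrite mulr_gt0 // subr_gt0.
  by rewrite -(pmulr_lgt0 _ mr); apply: le_lt_trans hE; rewrite !mulr_ge0 // ltW.
have h1 : r * s <= (E + 1) * (x * m).
  rewrite -(ler_pM2r s0); apply: le_trans (_ : (E + 1) * ((m - r) * m) <= _).
    by rewrite (le_trans _ (ltW hE)) // mulrC mulrA mulrAC.
  rewrite -mulrA; apply: ler_wpM2l; first exact: ltW.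
  by rewrite mulrAC; apply: ler_wpM2r => //; exact: ltW.
have h2 : `|(m - x * s) * s| <= r * s by rewrite normrM distrC (gtr0_norm s0) ler_wpM2r // ltW.
have h3 : `|(s * s - Q * m) * x| <= m * x.
  rewrite normrM (gtr0_norm x0) ler_wpM2r ?(ltW x0) // ger0_norm; lra.
by apply: le_trans (ler_normD _ _) _; rewrite (mulrC x m) in h1 *; lra.
Qed.

Lemma in_ball_div (a b : Z) : (0 < b)%Z -> in_ball (zr R a / zr R b) (bdiv a b).
Proof.
move=> b0; have := zr_divl (a * scale) b0; have := zr_divr (a * scale) b0.
rewrite /in_ball /bdiv /= zr1 zrM; have := @zr_lt R _ _ b0; rewrite zr0.
move: (zr R b) (zr R (_ / b)) => d q d0 h1 h2.
rewrite -(ler_pM2r d0) -[X in _ * X <= _](gtr0_norm d0) -normrM.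
have -> : (zr R a / d * S - q) * d = zr R a * S - q * d by field; rewrite gt_eqF.
by rewrite ger0_norm; lra.
Qed.

End Ball.

(** * Enclosures of matrices and states *)

Section BallMatrices.
Context (prec : positive).

Definition ball_mx := seq (seq zball).
Definition ball_coef (X : ball_mx) i j : zball := nth (0%Z, 0%Z) (nth [::] X i) j.
Definition ball_tab m n (f : nat -> nat -> zball) : ball_mx :=
  mkseq (fun i => mkseq (f i) n) m.
Definition ball_sum n (f : nat -> zball) : zball :=
  foldr (fun k => badd (f k)) (0%Z, 0%Z) (iota 0 n).

Definition bmx_add m n (X Y : ball_mx) :=
  ball_tab m n (fun i j => badd (ball_coef X i j) (ball_coef Y i j)).
Definition bmx_opp m n (X : ball_mx) :=
  ball_tab m n (fun i j => bopp (ball_coef X i j)).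
Definition bmx_mul m n p (X Y : ball_mx) :=
  ball_tab m p (fun i k =>
    ball_sum n (fun j => bmul prec (ball_coef X i j) (ball_coef Y j k))).
Definition bmx_scale m n (a : zball) (X : ball_mx) :=
  ball_tab m n (fun i j => bmul prec a (ball_coef X i j)).
Definition bmx_tr m n (X : ball_mx) := ball_tab n m (fun i j => ball_coef X j i).

Definition next3 (i : nat) : nat := (i.+1 %% 3)%N.

Definition bmx_adj3 (X : ball_mx) : ball_mx :=
  ball_tab 3 3 (fun i j =>
    badd (bmul prec (ball_coef X (next3 j) (next3 i))
                    (ball_coef X (next3 (next3 j)) (next3 (next3 i))))
         (bopp (bmul prec (ball_coef X (next3 j) (next3 (next3 i)))
                          (ball_coef X (next3 (next3 j)) (next3 i))))).
Definition bmx_det3 (X : ball_mx) : zball :=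
  ball_coef (bmx_mul 3 3 3 X (bmx_adj3 X)) 0 0.
Definition bmx_inv3 (X : ball_mx) : ball_mx :=
  bmx_scale 3 3 (binv prec (bmx_det3 X)) (bmx_adj3 X).

Definition ball_of_frac (r : Z * Z) : zball := bdiv prec r.1 r.2.
Definition bmx_of_rows m n (rows : seq (seq (Z * Z))) : ball_mx :=
  ball_tab m n (fun i j => ball_of_frac (nth (0%Z, 1%Z) (nth [::] rows i) j)).

Definition ball_state := (ball_mx * ball_mx)%type.

Definition ball_branch (K1 K2 b g1 g2 : ball_mx) (s : seq bool) (x : ball_state)
    : ball_state :=
  let a := ball_tab 3 1 (fun i j =>
    if nth true s i then ball_coef x.2 i j else bopp (ball_coef x.2 i j)) in
  let m := ball_tab 3 1 (fun i j =>
    if nth true s i then (0%Z, 0%Z) else ball_coef x.2 i j) in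
  let y := bmx_add 3 1 b (bmx_opp 3 1 a) in
  let u := bmx_add 3 1 (bmx_mul 3 3 1 K1 (bmx_add 3 1 y (bmx_opp 3 1 x.1)))
             (bmx_opp 3 1 g1) in
  let w := bmx_add 3 1 (bmx_mul 3 3 1 K2 (bmx_add 3 1 y (bmx_opp 3 1 u)))
             (bmx_opp 3 1 g2) in
  (w, bmx_add 3 1 (bmx_add 3 1 m b) (bmx_opp 3 1 (bmx_add 3 1 u w))).

Definition ball_size (x : zball) : Z := (Z.abs x.1 + x.2)%Z.
Definition ball_state_size (x : ball_state) : Z :=
  foldr (fun i => Z.max (Z.max (ball_size (ball_coef x.1 i 0)) (ball_size (ball_coef x.2 i 0))))
    0%Z (iota 0 3).

Definition ball_state_sub (x y : ball_state) : ball_state :=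
  (bmx_add 3 1 x.1 (bmx_opp 3 1 y.1), bmx_add 3 1 x.2 (bmx_opp 3 1 y.2)).

Definition ball_unit (b : bool) (i : nat) : ball_state :=
  let d := ball_tab 3 1 (fun k _ => if k == i then (scale prec, 0%Z) else (0%Z, 0%Z)) in
  let z := ball_tab 3 1 (fun _ _ => (0%Z, 0%Z)) in
  if b then (d, z) else (z, d).

(** When c1 and c2 enclose the columns of a linear map, this encloses its value.
    Powers of the cycle are computed in this way from its columns, because
    running through the 23 branches repeatedly would let the radii blow up. *)
Definition ball_comb (c1 c2 : seq ball_state) (x : ball_state) : ball_state :=
  let part (get : ball_state -> ball_mx) := ball_tab 3 1 (fun i j =>
    badd (ball_sum 3 (fun k => bmul prec (ball_coef x.1 k 0)
                                 (ball_coef (get (nth ([::], [::]) c1 k)) i j)))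
         (ball_sum 3 (fun k => bmul prec (ball_coef x.2 k 0)
                                 (ball_coef (get (nth ([::], [::]) c2 k)) i j)))) in
  (part fst, part snd).

Section Soundness.
Context {R : realFieldType}.
Local Notation enclosed := (@in_ball prec R).

Definition in_bmx m n (M : 'M[R]_(m, n)) (X : ball_mx) :=
  forall i j, enclosed (M i j) (ball_coef X i j).

Lemma ball_coef_tab m n f i j : (i < m)%N -> (j < n)%N ->
  ball_coef (ball_tab m n f) i j = f i j.
Proof. by move=> im jn; rewrite /ball_coef !nth_mkseq. Qed.

Lemma in_bmx_tab m n (M : 'M[R]_(m, n)) (f : nat -> nat -> zball) :
  (forall i j, enclosed (M i j) (f i j)) -> in_bmx M (ball_tab m n f).
Proof. by move=> h i j; rewrite ball_coef_tab. Qed.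

Lemma in_ball0 : enclosed 0 (0%Z, 0%Z).
Proof. by rewrite /in_ball /= mul0r subrr normr0. Qed.

Lemma in_ball1 : enclosed 1 (scale prec, 0%Z).
Proof. by rewrite /in_ball /= mul1r subrr normr0. Qed.

Lemma in_ball_sum n (F : 'I_n -> R) (f : nat -> zball) :
  (forall i : 'I_n, enclosed (F i) (f i)) -> enclosed (\sum_i F i) (ball_sum n f).
Proof.
move=> h; rewrite /ball_sum -val_enum_ord -big_enum /=.
elim: (enum 'I_n) => [|i s IH] /=; first by rewrite big_nil; apply: in_ball0.
by rewrite big_cons; apply: in_ballD.
Qed.

Lemma in_bmxD m n (M N : 'M[R]_(m, n)) X Y :
  in_bmx M X -> in_bmx N Y -> in_bmx (M + N) (bmx_add m n X Y).
Proof. by move=> hX hY; apply: in_bmx_tab => i j; rewrite mxE; apply: in_ballD. Qed.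

Lemma in_bmxN m n (M : 'M[R]_(m, n)) X : in_bmx M X -> in_bmx (- M) (bmx_opp m n X).
Proof. by move=> hX; apply: in_bmx_tab => i j; rewrite mxE; apply: in_ballN. Qed.

Lemma in_bmxB m n (M N : 'M[R]_(m, n)) X Y :
  in_bmx M X -> in_bmx N Y -> in_bmx (M - N) (bmx_add m n X (bmx_opp m n Y)).
Proof. by move=> hX hY; apply: in_bmxD => //; apply: in_bmxN. Qed.

Lemma in_bmxM m n p (M : 'M[R]_(m, n)) (N : 'M[R]_(n, p)) X Y :
  in_bmx M X -> in_bmx N Y -> in_bmx (M *m N) (bmx_mul m n p X Y).
Proof.
move=> hX hY; apply: in_bmx_tab => i j; rewrite mxE; apply: in_ball_sum => k.
exact: in_ballM.
Qed.

Lemma in_bmx_scale m n a (M : 'M[R]_(m, n)) x X :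
  enclosed a x -> in_bmx M X -> in_bmx (a *: M) (bmx_scale m n x X).
Proof. by move=> hx hX; apply: in_bmx_tab => i j; rewrite mxE; apply: in_ballM. Qed.

Lemma in_bmx_tr m n (M : 'M[R]_(m, n)) X : in_bmx M X -> in_bmx M^T (bmx_tr m n X).
Proof. by move=> hX; apply: in_bmx_tab => i j; rewrite mxE. Qed.

Lemma in_bmx_adj3 (M : 'M[R]_3) X : in_bmx M X -> in_bmx (adj3 M) (bmx_adj3 X).
Proof.
move=> hX; apply: in_bmx_tab => i j; rewrite mxE; apply: in_ballD.
  by apply: in_ballM; apply: hX.
by apply: in_ballN; apply: in_ballM; apply: hX.
Qed.

Lemma in_ball_det3 (M : 'M[R]_3) X : in_bmx M X -> enclosed (det3 M) (bmx_det3 X).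
Proof. by move=> hX; apply: (in_bmxM hX (in_bmx_adj3 hX)). Qed.

Definition ball_gt0 (X : zball) := (X.2 <? X.1)%Z.

Lemma in_ball_gt0 x X : enclosed x X -> ball_gt0 X -> 0 < x.
Proof.
rewrite /in_ball /ball_gt0 => + /Z.ltb_lt /(@zr_lt R).
by rewrite ler_norml -(pmulr_lgt0 _ (S_gt0 prec)) => /andP[]; lra.
Qed.

(** A positive enclosure of the determinant proves invertibility and at the same
    time makes the adjugate formula an enclosure of the inverse. *)
Lemma in_bmx_inv3 (M : 'M[R]_3) X : in_bmx M X -> ball_gt0 (bmx_det3 X) ->
  M \in unitmx /\ in_bmx (invmx M) (bmx_inv3 X).
Proof.
move=> hX d0; have hd := in_ball_det3 hX; have := in_ball_gt0 hd d0.
rewrite lt0r => /andP[/invmx3[uM ->] _]; split=> //.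
by apply: in_bmx_scale; [apply: in_ballV|apply: in_bmx_adj3].
Qed.

Local Notation V := ('cV[R]_3 * 'cV[R]_3)%type.
Definition in_state (x : V) (X : ball_state) := in_bmx x.1 X.1 /\ in_bmx x.2 X.2.

Lemma in_state_branch K1 K2 b g1 g2 s x X1 X2 Xb Y1 Y2 X :
  in_bmx K1 X1 -> in_bmx K2 X2 -> in_bmx b Xb -> in_bmx g1 Y1 -> in_bmx g2 Y2 ->
  in_state x X ->
  in_state (branch K1 K2 b g1 g2 (fun i => nth true s i) x)
    (ball_branch X1 X2 Xb Y1 Y2 s X).
Proof.
move=> h1 h2 hb k1 k2 [hw ht].
pose a : 'cV[R]_3 := signed_abs (fun i => nth true s i) x.2.
have ha : in_bmx a (ball_tab 3 1 (fun i j =>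
    if nth true s i then ball_coef X.2 i j else bopp (ball_coef X.2 i j))).
  by apply: in_bmx_tab => i j; rewrite mxE (ord1 j); case: nth => //; apply: in_ballN.
have hm : in_bmx (signed_neg (fun i => nth true s i) x.2) (ball_tab 3 1 (fun i j =>
    if nth true s i then (0%Z, 0%Z) else ball_coef X.2 i j)).
  by apply: in_bmx_tab => i j; rewrite mxE (ord1 j); case: nth => //; apply: in_ball0.
have hu : in_bmx (branch_u K1 b g1 (fun i => nth true s i) x) _ :=
  in_bmxB (in_bmxM h1 (in_bmxB (in_bmxB hb ha) hw)) k1.
have hw' := in_bmxB (in_bmxM h2 (in_bmxB (in_bmxB hb ha) hu)) k2.
by split; [exact: hw'|exact: (in_bmxB (in_bmxD hm hb) (in_bmxD hu hw'))].
Qed.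

Lemma in_stateB x y X Y : in_state x X -> in_state y Y ->
  in_state (x - y) (ball_state_sub X Y).
Proof. by move=> [h1 h2] [k1 k2]; split; apply: in_bmxB. Qed.

End Soundness.
End BallMatrices.

Section StateSoundness.
Context (prec : positive) {R : realType}.
Local Notation V := ('cV[R]_3 * 'cV[R]_3)%type.
Local Notation in_state := (@in_state prec R).
Local Notation S := (zr R (scale prec)).

Lemma in_ball_size x X : in_ball prec x X -> `|x| * S <= zr R (ball_size X).
Proof.
rewrite /in_ball /ball_size zrD zr_abs => h.
rewrite -[X in _ * X <= _](gtr0_norm (S_gt0 prec)) -normrM.
by have := ler_normD (x * S - zr R X.1) (zr R X.1); rewrite subrK; lra.
Qed.

Lemma in_state_size x X : in_state x X -> `|x| * S <= zr R (ball_state_size X).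
Proof.
move=> [h1 h2]; have S0 := S_gt0 prec (R := R).
have F (s : seq nat) (f : nat -> Z) i : i \in s ->
    (f i <= foldr (fun k => Z.max (f k)) 0%Z s)%Z.
  elim: s => //= k s IH; rewrite inE => /orP[/eqP->|/IH]; first exact: Z.le_max_l.
  by move/Z.le_trans; apply; apply: Z.le_max_r.
have F0 (s : seq nat) (f : nat -> Z) : (0 <= foldr (fun k => Z.max (f k)) 0%Z s)%Z.
  by elim: s => //= k s IH; apply: Z.le_trans IH (Z.le_max_r _ _).
rewrite -ler_pdivlMr //; apply/norm_state_le.
have B (M : 'cV[R]_3) Y : in_bmx prec M Y ->
    (forall i, (i < 3)%N -> (ball_size (ball_coef Y i 0) <= ball_state_size X)%Z) ->
    `|M| <= zr R (ball_state_size X) / S.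
  move=> hM hY; apply: norm_cV_le => [|i].
    by rewrite divr_ge0 ?(ltW S0) // -zr0; apply/zr_le/F0.
  rewrite ler_pdivlMr //; apply: le_trans (in_ball_size (hM i 0)) _.
  by apply/zr_le/hY.
split; [apply: (B _ _ h1)|apply: (B _ _ h2)] => i i3; rewrite /ball_state_size.
- apply: Z.le_trans (Z.le_max_l _ _) (F _ _ i _); by rewrite mem_iota.
- apply: Z.le_trans (Z.le_max_r _ _) (F _ _ i _); by rewrite mem_iota.
Qed.

Lemma in_state_unit b i : in_state (unit_state b i) (ball_unit prec b i).
Proof.
have h0 : in_bmx prec (0 : 'cV[R]_3) (ball_tab 3 1 (fun _ _ => (0%Z, 0%Z))).
  by apply: in_bmx_tab => k l; rewrite mxE; apply: in_ball0.
have h1 : in_bmx prec (delta_mx i 0 : 'cV[R]_3)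
    (ball_tab 3 1 (fun k _ => if k == i then (scale prec, 0%Z) else (0%Z, 0%Z))).
  apply: in_bmx_tab => k l; rewrite mxE (ord1 l) eqxx andbT -val_eqE /=.
  by case: (_ == _); [apply: in_ball1|apply: in_ball0].
by case: b; split.
Qed.

Lemma in_state_comb (f : V -> V) c1 c2 v X : linear f ->
  (forall i : 'I_3, in_state (f (unit_state true i)) (nth ([::], [::]) c1 i)) ->
  (forall i : 'I_3, in_state (f (unit_state false i)) (nth ([::], [::]) c2 i)) ->
  in_state v X -> in_state (f v) (ball_comb prec c1 c2 X).
Proof.
move=> lf h1 h2 [hw ht]; rewrite (linear_stateE lf).
have s1 (F : 'I_3 -> V) : (\sum_i F i).1 = \sum_i (F i).1 by exact: (big_morph fst).
have s2 (F : 'I_3 -> V) : (\sum_i F i).2 = \sum_i (F i).2 by exact: (big_morph snd).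
split.
- rewrite -[(_ + _).1]/(_.1 + _.1) !s1; apply: in_bmx_tab => i j.
  rewrite mxE !summxE; apply: in_ballD; apply: in_ball_sum => k.
    by rewrite -[(_ *: _).1]/(_ *: _.1) mxE; apply: in_ballM; [apply: hw|apply: (h1 k).1].
  by rewrite -[(_ *: _).1]/(_ *: _.1) mxE; apply: in_ballM; [apply: ht|apply: (h2 k).1].
- rewrite -[(_ + _).2]/(_.2 + _.2) !s2; apply: in_bmx_tab => i j.
  rewrite mxE !summxE; apply: in_ballD; apply: in_ball_sum => k.
    by rewrite -[(_ *: _).2]/(_ *: _.2) mxE; apply: in_ballM; [apply: hw|apply: (h1 k).2].
  by rewrite -[(_ *: _).2]/(_ *: _.2) mxE; apply: in_ballM; [apply: ht|apply: (h2 k).2].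
Qed.

End StateSoundness.

(** * The numerical certificate of an attracting cycle *)

Section Certificate.
Context (prec : positive).

Section Enclosures.
Context (itinerary : seq (seq bool)) (X1 X2 Xb Y1 Y2 : ball_mx).

Definition ball_iter_branch n x :=
  iteri n (fun j => ball_branch prec X1 X2 Xb Y1 Y2 (nth [::] itinerary j)) x.

Definition ball_signs_ok (s : seq bool) (x : ball_state) :=
  all (fun i => let y := ball_coef x.2 i 0 in
    if nth true s i then (scale prec <=? 1000 * (y.1 - y.2))%Z
    else (scale prec <=? 1000 * (- y.1 - y.2))%Z) (iota 0 3).

Fixpoint ball_orbit_ok n j x :=
  if n is n'.+1 then
    ball_signs_ok (nth [::] itinerary j) x &&
    ball_orbit_ok n' j.+1 (ball_branch prec X1 X2 Xb Y1 Y2 (nth [::] itinerary j) x)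
  else true.
End Enclosures.

Definition ball_widen (e : Z) (x : ball_state) : ball_state :=
  let w X := ball_tab 3 1 (fun i j => ((ball_coef X i j).1, ((ball_coef X i j).2 + e)%Z)) in
  (w x.1, w x.2).

Definition total_size (xs : seq ball_state) : Z :=
  foldr (fun x => Z.add (ball_state_size x)) 0%Z xs.

Definition ball_zero : ball_mx := ball_tab 3 1 (fun _ _ => (0%Z, 0%Z)).

Definition ball_column itinerary X1 X2 (b : bool) (i : nat) : ball_state :=
  ball_iter_branch itinerary X1 X2 ball_zero ball_zero ball_zero (size itinerary)
    (ball_unit prec b i).

(** The four conditions bound the sum of the column norms of L by 3, that of
    L^6 by 3/4, then 4 * 364 times the residual at the center c by e, and
    check the signs along the orbit of the box of radius e around c.  Here
    364 = 1 + 3 + ... + 3^5 comes from the bound 3 on L, and 4 = 1 / (1 - 3/4)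
    from the bound on L^6. *)
Definition cycle_certificate itinerary X1 X2 Xb Y1 Y2 (c : ball_state) (e : Z) : bool :=
  let c1 := map (ball_column itinerary X1 X2 true) (iota 0 3) in
  let c2 := map (ball_column itinerary X1 X2 false) (iota 0 3) in
  let pow x := iter 5 (ball_comb prec c1 c2) x in
  let res := ball_state_sub
     (ball_iter_branch itinerary X1 X2 Xb Y1 Y2 (size itinerary) c) c in
  [&& (total_size (c1 ++ c2) <=? 3 * scale prec)%Z,
      (4 * total_size (map pow (c1 ++ c2)) <=? 3 * scale prec)%Z,
      (4 * 364 * ball_state_size res <=? e)%Z &
      ball_orbit_ok itinerary X1 X2 Xb Y1 Y2 (size itinerary) 0 (ball_widen e c)].
End Certificate.

Lemma residual_scale (R : realFieldType) (a r s t : R) :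
  0 < s -> (1 - 3 / 4) * a <= 364 * r -> r * s <= t -> a * s <= 1456 * t.
Proof.
move=> s0 ar rt; have h : a <= 1456 * r by lra.
have := ler_wpM2r (ltW s0) h; rewrite -mulrA => h2; lra.
Qed.

Section CertificateSound.
Context (prec : positive) {R : realType}.
Local Notation V := ('cV[R]_3 * 'cV[R]_3)%type.
Local Notation in_state := (@in_state prec R).
Local Notation in_bmx := (@in_bmx prec R).
Local Notation S := (zr R (scale prec)).
Context (itinerary : seq (seq bool)).
Local Notation sign_at := (sign_at itinerary).
Local Notation itinerary_branch := (itinerary_branch itinerary).

Section Fixed.
Context (K1 K2 : 'M[R]_3) (b g1 g2 : 'cV[R]_3) (X1 X2 Xb Y1 Y2 : ball_mx).
Context (h1 : in_bmx K1 X1) (h2 : in_bmx K2 X2) (hb : in_bmx b Xb).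
Context (k1 : in_bmx g1 Y1) (k2 : in_bmx g2 Y2).
Local Notation G := (itinerary_branch K1 K2 b g1 g2).

Lemma in_state_iter n x X : in_state x X ->
  in_state (iteri n G x) (ball_iter_branch prec itinerary X1 X2 Xb Y1 Y2 n X).
Proof.
by move=> hX; elim: n => //= n IH; apply: in_state_branch.
Qed.

Lemma ball_signs_okP s (x : V) X : in_state x X -> ball_signs_ok prec s X ->
  signs_margin (zr R 1000)^-1 (fun i => nth true s i) x.
Proof.
move=> [_ hX] /allP ok i; have := ok i; rewrite mem_iota ltn_ord => /(_ isT).
have := hX i 0; rewrite /in_ball ler_norml; set y := ball_coef _ _ _ => /andP[l1 l2].
have S0 := S_gt0 prec (R := R).
have t0 : 0 < zr R 1000 by rewrite -zr0; apply: zr_lt.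
case: nth => /Z.leb_le /(@zr_le R); rewrite zrM !zrD !zrN => h.
  rewrite -(ler_pM2r S0) -(ler_pM2l t0) mulVKf ?gt_eqF //.
  apply: le_trans h _; apply: ler_wpM2l; [exact: ltW|lra].
rewrite -(ler_pM2r S0) -(ler_pM2l t0) mulNr mulrN mulVKf ?gt_eqF // lerNr.
rewrite -mulrN; apply: le_trans h _; apply: ler_wpM2l; [exact: ltW|lra].
Qed.

Lemma ball_orbit_okP n j x X : in_state (iteri j G x) X ->
  ball_orbit_ok prec itinerary X1 X2 Xb Y1 Y2 n j X ->
  forall i, (j <= i < j + n)%N ->
    signs_margin (zr R 1000)^-1 (sign_at i) (iteri i G x).
Proof.
elim: n j X => [|n IH] j X hX /=.
  by move=> _ i; rewrite addn0 leqNgt andbC; case: leq.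
case/andP=> ok1 ok i /andP[]; rewrite leq_eqVlt => /predU1P[<- _|ji iN].
  exact: ball_signs_okP hX ok1.
by apply: IH ok _ _; [exact: in_state_branch|rewrite ji addSnnS].
Qed.

End Fixed.

Lemma total_size_cat xs ys : total_size (xs ++ ys) = (total_size xs + total_size ys)%Z.
Proof. by elim: xs => //= x xs IH; rewrite IH Z.add_assoc. Qed.

Lemma total_size_ge (f : 'I_3 -> V) (X : nat -> ball_state) :
  (forall i : 'I_3, in_state (f i) (X i)) ->
  (\sum_i `|f i|) * S <= zr R (total_size (map X (iota 0 3))).
Proof.
move=> h; rewrite -val_enum_ord -big_enum /= mulr_suml.
elim: (enum 'I_3) => [|i s IH] /=; first by rewrite big_nil.
by rewrite big_cons zrD lerD // in_state_size.
Qed.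

Lemma in_state_widen x c X e : in_state c X -> `|x - c| * S <= zr R e ->
  in_state x (ball_widen e X).
Proof.
move=> [h1 h2]; rewrite -ler_pdivlMr ?S_gt0 // => /norm_state_le[].
rewrite -[(x - c).1]/(x.1 - c.1) -[(x - c).2]/(x.2 - c.2).
have H (u v : 'cV[R]_3) Y : in_bmx v Y -> `|u - v| <= zr R e / S ->
   in_bmx u (ball_tab 3 1 (fun i j => ((ball_coef Y i j).1, ((ball_coef Y i j).2 + e)%Z))).
  move=> hY huv; apply: in_bmx_tab => i j; rewrite (ord1 j) /in_ball /= zrD.
  have -> : u i 0 * S - zr R (ball_coef Y i 0).1 =
     (v i 0 * S - zr R (ball_coef Y i 0).1) + (u - v) i 0 * S by rewrite !mxE; ring.
  apply: le_trans (ler_normD _ _) _; apply: lerD; first exact: hY.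
  rewrite normrM (gtr0_norm (S_gt0 prec)) -ler_pdivlMr ?S_gt0 //.
  exact: le_trans (norm_coord_le _ _) huv.
by move=> d1 d2; split; [apply: H h1 d1|apply: H h2 d2].
Qed.

(** The fixed point exists by linear algebra alone.  It is then located by
    [near_fixpoint_le], and the checked box contains it. *)
Theorem cycle_certificateP K1 K2 b g1 g2 X1 X2 Xb Y1 Y2 c C e :
  in_bmx K1 X1 -> in_bmx K2 X2 -> in_bmx b Xb -> in_bmx g1 Y1 -> in_bmx g2 Y2 ->
  in_state c C -> cycle_certificate prec itinerary X1 X2 Xb Y1 Y2 C e ->
  let N := size itinerary in
  let G := itinerary_branch K1 K2 b g1 g2 in
  let D := itinerary_branch K1 K2 0 0 0 in
  exists x0 : V, [/\ iteri N G x0 = x0,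
    forall j, (j < N)%N -> signs_margin (zr R 1000)^-1 (sign_at j) (iteri j G x0) &
    forall v, `|iter 6 (iteri N D) v| <= 3 / 4 * `|v|].
Proof.
move=> h1 h2 hb k1 k2 hc /and4P[q1 q6 res ok] N G D.
have hz : in_bmx (0 : 'cV[R]_3) ball_zero.
  by apply: in_bmx_tab => i j; rewrite mxE; apply: in_ball0.
pose col := ball_column prec itinerary X1 X2.
rewrite -/(col true) -/(col false) in q1 q6.
set L := iteri N D; have S0 := S_gt0 prec (R := R).
have lD j : linear (D j) by apply: branch_linear.
have lL : linear L by apply: iteri_linear.
have lLk k : linear (iter k L).
  by elim: k => [//|k IH] a x y; rewrite /= IH lL.
have hcol b' (i : 'I_3) : in_state (L (unit_state b' i)) (col b' i).
  by apply: in_state_iter => //; apply: in_state_unit.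
have hcomb v X : in_state v X ->
    in_state (L v) (ball_comb prec (map (col true) (iota 0 3)) (map (col false) (iota 0 3)) X).
  by apply: in_state_comb => // i; rewrite (nth_map 0%N) ?size_iota // nth_iota.
have bound k (a : R) (X : bool -> nat -> ball_state) :
    (forall b' (i : 'I_3), in_state (iter k L (unit_state b' i)) (X b' i)) ->
    zr R (total_size (map (X true) (iota 0 3) ++ map (X false) (iota 0 3))) <= a * S ->
    forall v, `|iter k L v| <= a * `|v|.
  move=> hX hs v; apply: le_trans (norm_linear_le (lLk k) v) _; apply: ler_wpM2r => //.
  rewrite -(ler_pM2r S0) big_bool mulrDl; apply: le_trans hs.
  by rewrite total_size_cat zrD; apply: lerD; apply: total_size_ge => i; apply: hX.
have L1 v : `|L v| <= 3 * `|v|.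
  apply: (bound 1%N _ col) => //; move/Z.leb_le/(@zr_le R): q1; rewrite zrM.
  exact.
(* The columns are images under L already: five more applications give L^6. *)
have L6 v : `|iter 6 L v| <= 3 / 4 * `|v|.
  pose comb := ball_comb prec (map (col true) (iota 0 3)) (map (col false) (iota 0 3)).
  apply: (bound 6%N _ (fun b' i => iter 5 comb (col b' i))).
    move=> b' i; rewrite (iterD 5 1) /=.
    by do 5 apply: (hcomb _ _ _); apply: hcol.
  move/Z.leb_le/(@zr_le R): q6; rewrite map_cat -!map_comp.
  move: (total_size _) => T; rewrite !zrM (_ : zr R 4 = 4) // (_ : zr R 3 = 3) //.
  by lra.
have GL x y : iteri N G x - iteri N G y = L (x - y).
  by apply: iteri_affine => j u v; apply: branch_affine.
have [x0 fx0] : exists x0, iteri N G x0 = x0.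
  apply: (affine_fixpoint lL GL) => v Lv; apply/eqP; rewrite -normr_eq0.
  have : iter 6 L v = v by rewrite /= !Lv.
  move=> E; move: (L6 v) (normr_ge0 v); rewrite E; move: `|v| => a; clear; lra.
exists x0; split=> //.
have hr : in_state (iteri N G c - c) _ := in_stateB (in_state_iter h1 h2 hb k1 k2 N hc) hc.
have LB u v : L u - L v = L (u - v).
  by apply: iteri_affine => j u' v'; apply: branch_affine.
have eL : (x0 - c) - L (x0 - c) = iteri N G c - c.
  by rewrite -GL fx0 opprB addrC addrA subrK.
have := near_fixpoint_le LB L1 L6 (ler0n _ 3) eL => /= near.
have close : `|x0 - c| * S <= zr R e.
  move/Z.leb_le/(@zr_le R): res; rewrite zrM; apply: le_trans.
  rewrite (_ : zr R (4 * 364) = 1456); last first.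
    by rewrite /zr (_ : int_of_Z _ = Posz 1456) -?pmulrn //; vm_compute.
  by apply: residual_scale S0 _ (in_state_size hr); move: near; clear; lra.
move=> j jN; apply: (ball_orbit_okP h1 h2 hb k1 k2 _ ok) => //=.
exact: in_state_widen hc close.
Qed.

End CertificateSound.

(** * The data *)

Open Scope Z_scope.
(** The entries of the data as pairs of binary integers, the form in which
    their enclosures can be computed. *)
Definition fracs_A : seq (seq (Z * Z)) :=
  [:: [:: (5, 36);  (1, 60);  (25, 97)];
      [:: (1, 60);  (5, 77);  (5, 91)];
      [:: (25, 97); (5, 91);  (11, 12)]].
Definition fracs_B : seq (seq (Z * Z)) :=
  [:: [:: (4, 61);  (1, 54);  (5, 83)];
      [:: (1, 54);  (13, 92); (23, 88)];
      [:: (5, 83);  (23, 88); (53, 58)]].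
Definition fracs_Qx : seq (seq (Z * Z)) :=
  [:: [:: (85, 93);   (-1, 57); (-3, 11)];
      [:: (-1, 57); (99, 100);  (-5, 86)];
      [:: (-3, 11); (-5, 86); (7, 78)]].
Definition fracs_Qy : seq (seq (Z * Z)) :=
  [:: [:: (99, 100);  (-1, 51);  (-3, 47)];
      [:: (-1, 51); (72, 79);    (-18, 65)];
      [:: (-3, 47); (-18, 65); (4, 43)]].
Definition fracs_b : seq (seq (Z * Z)) :=
  [:: [:: (-2, 17)]; [:: (-1, 14)]; [:: (56, 73)]].
Definition fracs_c1 : seq (seq (Z * Z)) :=
  [:: [:: (33, 98)]; [:: (-33, 25)]; [:: (-24, 55)]].
Definition fracs_c2 : seq (seq (Z * Z)) :=
  [:: [:: (-31, 99)]; [:: (19, 36)]; [:: (-11, 20)]].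
(** The point ([fracs_w], [fracs_t]) is the phase-zero state of the cycle,
    rounded to 26 decimals. *)
Definition fracs_w : seq (seq (Z * Z)) :=
  [:: [:: (-11835609599868454848733288, 10 ^ 26)];
      [:: (-62672826694577204422343757, 10 ^ 26)];
      [:: (-190823643399968248950770935, 10 ^ 26)]].
Definition fracs_t : seq (seq (Z * Z)) :=
  [:: [:: (-4691224546471402027672713, 10 ^ 26)];
      [:: (12741313518431507433767216, 10 ^ 26)];
      [:: (242225480048457252374479665, 10 ^ 26)]].
Close Scope Z_scope.

(** The sign vectors of t met during one period, [true] meaning positive. *)
Definition itinerary : seq (seq bool) :=
  nseq 7 [:: false; true; true] ++ nseq 2 [:: false; false; true] ++
  [:: [:: false; false; false]] ++ nseq 8 [:: false; false; true] ++
  nseq 5 [:: true; false; true].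

Section Fractions.
Context {F : numFieldType}.

Definition frac (r : Z * Z) : F := zr F r.1 / zr F r.2.

Lemma frac_neg (n : positive) d : frac (Zneg n, d) = - frac (Zpos n, d).
Proof. by rewrite /frac -mulNr -zrN. Qed.

Definition mx_of_fracs m n (rows : seq (seq (Z * Z))) : 'M[F]_(m, n) :=
  \matrix_(i, j) frac (nth (0%Z, 1%Z) (nth [::] rows i) j).

End Fractions.

Lemma map_mx_of_fracs (R : realType) m n rows :
  map_mx (ratr : rat -> R) (mx_of_fracs m n rows) = mx_of_fracs m n rows.
Proof.
by apply/matrixP => i j; rewrite !mxE /frac fmorph_div /= /zr !ratr_int.
Qed.

Lemma in_bmx_of_rows prec (R : realType) m n rows :
  all (all (fun r => (0 <? r.2)%Z)) rows ->
  in_bmx prec (mx_of_fracs m n rows : 'M[R]_(m, n)) (bmx_of_rows prec m n rows).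
Proof.
move=> h; apply: in_bmx_tab => i j; rewrite mxE; apply: in_ball_div.
have [ir|ir] := ltnP i (size rows); last by rewrite (nth_default [::]) // nth_nil.
have /(allP h) h2 := mem_nth [::] ir.
have [jr|jr] := ltnP j (size (nth [::] rows i)); last by rewrite nth_default.
by apply/Z.ltb_lt; exact: (allP h2 _ (mem_nth _ jr)).
Qed.

Lemma hatA_fracs : hatA = mx_of_fracs 3 3 fracs_A.
Proof.
apply/matrixP => -[[|[|[|//]]] hi] [[|[|[|//]]] hj]; rewrite !mxE /= ?frac_neg; reflexivity.
Qed.

Lemma hatB_fracs : hatB = mx_of_fracs 3 3 fracs_B.
Proof.
apply/matrixP => -[[|[|[|//]]] hi] [[|[|[|//]]] hj]; rewrite !mxE /= ?frac_neg; reflexivity.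
Qed.

Lemma hatQx_fracs : hatQx = mx_of_fracs 3 3 fracs_Qx.
Proof.
apply/matrixP => -[[|[|[|//]]] hi] [[|[|[|//]]] hj]; rewrite !mxE /= ?frac_neg; reflexivity.
Qed.

Lemma hatQy_fracs : hatQy = mx_of_fracs 3 3 fracs_Qy.
Proof.
apply/matrixP => -[[|[|[|//]]] hi] [[|[|[|//]]] hj]; rewrite !mxE /= ?frac_neg; reflexivity.
Qed.

Lemma hatb_fracs : hatb = mx_of_fracs 3 1 fracs_b.
Proof.
apply/matrixP => -[[|[|[|//]]] hi] [[|//] hj]; rewrite !mxE /= ?frac_neg; reflexivity.
Qed.

Lemma hatc1_fracs : hatc1 = mx_of_fracs 3 1 fracs_c1.
Proof.
apply/matrixP => -[[|[|[|//]]] hi] [[|//] hj]; rewrite !mxE /= ?frac_neg; reflexivity.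
Qed.

Lemma hatc2_fracs : hatc2 = mx_of_fracs 3 1 fracs_c2.
Proof.
apply/matrixP => -[[|[|[|//]]] hi] [[|//] hj]; rewrite !mxE /= ?frac_neg; reflexivity.
Qed.

(** The resolvent of the transformed Hessian involves only the inverse of the
    normal matrix Q + A^T A, which is close to the identity for both blocks. *)
Lemma res_congr (F : fieldType) n (A Q : 'M[F]_n) :
  A \in unitmx -> Q + A^T *m A \in unitmx ->
  invmx ((invmx A)^T *m Q *m invmx A + 1%:M) = A *m invmx (Q + A^T *m A) *m A^T.
Proof.
move=> uA uH; set M := _ + 1%:M.
have MA : M *m A = (invmx A)^T *m (Q + A^T *m A).
  rewrite mulmxDl mul1mx mulmxDr (mulmxKV uA) (mulmxA _ A^T) -trmx_mul.
  by rewrite mulmxV // trmx1 mul1mx.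
have e : M *m (A *m invmx (Q + A^T *m A) *m A^T) = 1%:M.
  by rewrite !mulmxA MA (mulmxK uH) -trmx_mul mulmxV // trmx1.
have [uM _] := mulmx1_unit e.
by rewrite -[RHS](mulKmx uM) e mulmx1.
Qed.

Section Resolvent.
Context (prec : positive) {R : realType}.

Definition ball_normal (A Q : ball_mx) : ball_mx :=
  bmx_add 3 3 Q (bmx_mul prec 3 3 3 (bmx_tr 3 3 A) A).

Definition ball_solve (A Q : ball_mx) : ball_mx :=
  bmx_mul prec 3 3 3 A (bmx_inv3 prec (ball_normal A Q)).

Definition ball_res (A Q : ball_mx) : ball_mx :=
  bmx_mul prec 3 3 3 (ball_solve A Q) (bmx_tr 3 3 A).

Definition ball_posdef (Q : ball_mx) :=
  [&& ball_gt0 (ball_coef Q 0 0), ball_gt0 (ball_coef (bmx_adj3 prec Q) 2 2) &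
      ball_gt0 (bmx_det3 prec Q)].

Lemma ball_posdefP (Q : 'M[R]_3) X : Q^T = Q -> in_bmx prec Q X -> ball_posdef X ->
  posdef Q.
Proof.
move=> sQ hX /and3P[p1 p2 p3]; apply: posdef3 => //.
- exact: in_ball_gt0 (hX 0 0) p1.
- have := in_bmx_adj3 hX (ordS (ordS 0)) (ordS (ordS 0)).
  rewrite (_ : nat_of_ord (ordS (ordS 0)) = 2%N) // => h.
  exact: in_ball_gt0 h p2.
- exact: in_ball_gt0 (in_ball_det3 hX) p3.
Qed.

Lemma in_bmx_res (A Q : 'M[R]_3) (c : 'cV[R]_3) XA XQ Xc :
  in_bmx prec A XA -> in_bmx prec Q XQ -> in_bmx prec c Xc ->
  ball_gt0 (bmx_det3 prec XA) -> ball_gt0 (bmx_det3 prec (ball_normal XA XQ)) ->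
  let K := invmx ((invmx A)^T *m Q *m invmx A + 1%:M) in
  in_bmx prec K (ball_res XA XQ) /\
  in_bmx prec (K *m ((invmx A)^T *m c)) (bmx_mul prec 3 3 1 (ball_solve XA XQ) Xc).
Proof.
move=> hA hQ hc dA dH.
have [uA _] := in_bmx_inv3 hA dA.
have hH : in_bmx prec (Q + A^T *m A) (ball_normal XA XQ).
  by apply: in_bmxD => //; apply: in_bmxM => //; apply: in_bmx_tr.
have [uH hi] := in_bmx_inv3 hH dH.
rewrite /= res_congr //; split; first by apply: in_bmxM (in_bmx_tr hA); apply: in_bmxM.
rewrite [in X in in_bmx _ X]mulmxA -(mulmxA _ A^T) -trmx_mul mulVmx // trmx1 mulmx1.
by apply: in_bmxM => //; apply: in_bmxM.
Qed.

(** The positive definiteness of the Hessians, the invertibility of A and B, and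
    the enclosures needed for the cycle are all decided from the same balls. *)
Definition data_certificate (itinerary : seq (seq bool))
    (A B Qx Qy b c1 c2 w t : ball_mx) (e : Z) : bool :=
  [&& ball_gt0 (bmx_det3 prec A), ball_gt0 (bmx_det3 prec B),
      ball_posdef Qx, ball_posdef Qy,
      ball_gt0 (bmx_det3 prec (ball_normal A Qx)),
      ball_gt0 (bmx_det3 prec (ball_normal B Qy)) &
      cycle_certificate prec itinerary (ball_res A Qx) (ball_res B Qy) b
        (bmx_mul prec 3 3 1 (ball_solve A Qx) c1)
        (bmx_mul prec 3 3 1 (ball_solve B Qy) c2) (w, t) e].

Theorem data_certificateP (p : slack_qp R 3) (w t : 'cV[R]_3)
    itinerary XA XB XQx XQy Xb Xc1 Xc2 Xw Xt e :
  in_bmx prec (mxA p) XA -> in_bmx prec (mxB p) XB ->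
  in_bmx prec (hessx p) XQx -> in_bmx prec (hessy p) XQy ->
  in_bmx prec (rhs p) Xb -> in_bmx prec (linx p) Xc1 -> in_bmx prec (liny p) Xc2 ->
  in_bmx prec w Xw -> in_bmx prec t Xt ->
  (hessx p)^T = hessx p -> (hessy p)^T = hessy p ->
  prime (size itinerary) ->
  (exists j k i, [/\ (j < size itinerary)%N, (k < size itinerary)%N &
    sign_at itinerary j i <> sign_at itinerary k i]) ->
  data_certificate itinerary XA XB XQx XQy Xb Xc1 Xc2 Xw Xt e ->
  [/\ mxA p \in unitmx, mxB p \in unitmx, posdef (hessx p), posdef (hessy p) &
      exists s, attracting_nonKKT_cycle (transformed p) (size itinerary) s].
Proof.
move=> hA hB hQx hQy hb hc1 hc2 hw ht sx sy N_prime nonconst.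
move=> /and4P[dA dB px /and4P[py dHx dHy cert]].
have [uA _] := in_bmx_inv3 hA dA; have [uB _] := in_bmx_inv3 hB dB.
have pdx := ball_posdefP sx hQx px; have pdy := ball_posdefP sy hQy py.
split=> //; pose q := transformed p.
have [k1 g1] : in_bmx prec (resx q) _ /\ in_bmx prec (resx q *m linx q) _ :=
  in_bmx_res hA hQx hc1 dA dHx.
have [k2 g2] : in_bmx prec (resy q) _ /\ in_bmx prec (resy q *m liny q) _ :=
  in_bmx_res hB hQy hc2 dB dHy.
have hwt : in_state prec (w, t) (Xw, Xt) by [].
have [x0 [fx mar con]] := cycle_certificateP k1 k2 hb g1 g2 hwt cert.
have mu0 : 0 < (zr R 1000)^-1 by rewrite invr_gt0 -zr0; apply: zr_lt.
have pqx : posdef (hessx q) by apply: posdef_transformed.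
have pqy : posdef (hessy q) by apply: posdef_transformed.
have q34 : 0 <= (3 / 4 : R) < 1 by lra.
exact: (itinerary_cycle (p := q) erefl erefl pqx pqy N_prime mu0
  (isT : (0 < 6)%N) q34 fx mar con nonconst).
Qed.

End Resolvent.

(** Radii grow by a factor of about 10^14 along one period, so 160 bits leave
    the residual below what the box radius 10^-20 requires; that radius grows to
    about 10^-6, well below the smallest |t| on the orbit, about 0.0045. *)
Lemma hat_certificate : data_certificate 160 itinerary
  (bmx_of_rows 160 3 3 fracs_A) (bmx_of_rows 160 3 3 fracs_B)
  (bmx_of_rows 160 3 3 fracs_Qx) (bmx_of_rows 160 3 3 fracs_Qy)
  (bmx_of_rows 160 3 1 fracs_b) (bmx_of_rows 160 3 1 fracs_c1) (bmx_of_rows 160 3 1 fracs_c2)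
  (bmx_of_rows 160 3 1 fracs_w) (bmx_of_rows 160 3 1 fracs_t) (scale 160 / 10 ^ 20)%Z.
Proof. by vm_compute. Qed.

Lemma in_bmx_map_fracs prec (R : realType) m n rows (M : 'M[rat]_(m, n)) :
  M = mx_of_fracs m n rows -> all (all (fun r => (0 <? r.2)%Z)) rows ->
  in_bmx prec (map_mx (ratr : rat -> R) M) (bmx_of_rows prec m n rows).
Proof. by move=> ->; rewrite map_mx_of_fracs; apply: in_bmx_of_rows. Qed.

Lemma hatQx_sym : hatQx^T = hatQx.
Proof.
by apply/matrixP => -[[|[|[|//]]] hi] [[|[|[|//]]] hj]; rewrite !mxE.
Qed.

Lemma hatQy_sym : hatQy^T = hatQy.
Proof.
by apply/matrixP => -[[|[|[|//]]] hi] [[|[|[|//]]] hj]; rewrite !mxE.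
Qed.

Lemma hat_cycle (R : realType) : let p : slack_qp R 3 := map_qp ratr hat_qp in
  [/\ mxA p \in unitmx, mxB p \in unitmx, posdef (hessx p), posdef (hessy p) &
      exists s, attracting_nonKKT_cycle (transformed p) 23 s].
Proof.
have symR (Q : 'M[rat]_3) : Q^T = Q -> (map_mx (ratr : rat -> R) Q)^T = map_mx ratr Q.
  by move=> sQ; rewrite matrix.map_trmx sQ.
have nonconst : exists j k i, [/\ (j < size itinerary)%N, (k < size itinerary)%N &
    sign_at itinerary j i <> sign_at itinerary k i] by exists 0%N, 7%N, 1.
have N_prime : prime (size itinerary) by [].
apply: (@data_certificateP 160 R (map_qp ratr hat_qp) (mx_of_fracs 3 1 fracs_w)
  (mx_of_fracs 3 1 fracs_t) itinerary).
- exact: (in_bmx_map_fracs _ _ hatA_fracs isT).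
- exact: (in_bmx_map_fracs _ _ hatB_fracs isT).
- exact: (in_bmx_map_fracs _ _ hatQx_fracs isT).
- exact: (in_bmx_map_fracs _ _ hatQy_fracs isT).
- exact: (in_bmx_map_fracs _ _ hatb_fracs isT).
- exact: (in_bmx_map_fracs _ _ hatc1_fracs isT).
- exact: (in_bmx_map_fracs _ _ hatc2_fracs isT).
- exact: (@in_bmx_of_rows 160 R 3 1 fracs_w isT).
- exact: (@in_bmx_of_rows 160 R 3 1 fracs_t isT).
- exact: symR hatQx_sym.
- exact: symR hatQy_sym.
- exact: N_prime.
- exact: nonconst.
- exact: hat_certificate.
Qed.

Theorem corollary4p2 (R : realType) :
  let p : slack_qp R 3 := map_qp ratr hat_qp in
  let q : slack_qp R 3 := map_qp ratr (transformed hat_qp) in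
  [/\ (hatA \in unitmx) /\ (hatB \in unitmx),
      equivalent_via (fun v => let: (x, y, z) := v in (mxA p *m x, mxB p *m y, z))
        (program_of p) (program_of q),
      strongly_convex (quad (hessx q) (linx q)) /\
      strongly_convex (quad (hessy q) (liny q)),
      [/\ posdef (hessx p), posdef (hessy p), posdef (hessx q) & posdef (hessy q)] &
      exists s : nat -> iterate R 3, attracting_nonKKT_cycle q 23 s] /\
  (exists q' : slack_qp rat 3,
     [/\ mxA q' = 1%:M, mxB q' = 1%:M,
         posdef (map_mx (ratr : rat -> R) (hessx q')),
         posdef (map_mx (ratr : rat -> R) (hessy q')) &
         exists s : nat -> iterate R 3,
           attracting_nonKKT_cycle (map_qp ratr q') 23 s]).
Proof.
move=> p q.
have [uA uB pdx pdy cyc_p] := hat_cycle R.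
have qE : q = transformed p by apply: map_transformed.
have cyc : exists s, attracting_nonKKT_cycle q 23 s by rewrite qE; exact: cyc_p.
have pqx : posdef (hessx q) by rewrite qE; apply: posdef_transformed.
have pqy : posdef (hessy q) by rewrite qE; apply: posdef_transformed.
split; last first.
  exact: (ex_intro _ (transformed hat_qp) (And5 erefl erefl pqx pqy cyc)).
split=> //.
- by rewrite -!(map_unitmx (ratr : rat -> R)).
- by rewrite qE; apply: equivalent_transformed.
- by split; apply: posdef_strongly_convex.
Qed.
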